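(* For every integer $k\ge 1$, there exists a connected nilpotent real Lie group which is Diophantine for $k$-tuples, but not Diophantine for $(k+1)$-tuples.
   Context: Let $G$ be a connected real Lie group with a left-invariant Riemannian metric $d$. For a subgroup $\Gamma=\langle S\rangle$ with finite generating set $S$, let $B_\Gamma(n)=(S\cup S^{-1}\cup\{1\})^n$ and $\delta_\Gamma(n)=\min\{d(x,1): x\in B_\Gamma(n),\ x\ne 1\}$ ($+\infty$ if there is no such $x$). For $\beta>0$, $\Gamma$ is $\beta$-Diophantine if there is $c>0$ such that $\delta_\Gamma(n)\ge c\,|B_\Gamma(n)|^{-\beta}$ for all $n\ge 1$. (For $G$ nilpotent this depends neither on $S$ nor on $d$.) $G$ is Diophantine for $k$-tuples if there is $\beta=\beta(k)>0$ such that almost every $k$-tuple in $G^k$ (for Haar measure) generates a $\beta$-Diophantine subgroup (with the $k$-tuple as generating set). *)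

(* Defs.v *)
From HB Require Import structures.
From mathcomp Require Import all_boot all_order all_algebra.
From mathcomp Require Import finmap all_classical all_reals all_analysis.
Set Implicit Arguments.
Unset Strict Implicit.
Unset Printing Implicit Defensive.
Import Order.TTheory GRing.Theory Num.Theory.
Import numFieldNormedType.Exports.
Local Open Scope classical_set_scope.
Local Open Scope ring_scope.

Definition iter_derive (R : numFieldType) (V W : normedModType R)
    (vs : seq V) (f : V -> W) : V -> W :=
  foldr (fun v h x => 'D_v h x) f vs.

(* f is C^oo on A: all iterated directional derivatives exist and are
   continuous on A.  In finite dimension and for A open, which is how it is
   used below, this is the usual notion. *)
Definition smooth_on (R : numFieldType) (V W : normedModType R)
    (A : set V) (f : V -> W) : Prop :=
  forall (vs : seq V) (x : V), A x ->
    {for x, continuous (iter_derive vs f)} /\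
    (forall v : V, derivable (iter_derive vs f) x v).

(* The atlas is indexed by the points of G: [chart p], with inverse
   [chart_inv p], is a chart whose domain [chart_dom p] contains p.  The values
   of [chart p] outside [chart_dom p], and of [chart_inv p] outside the image of
   [chart_dom p], are irrelevant. *)
HB.mixin Record isLieGroup (R : realType) (n : nat) G
    & Group G & Topological G := {
  lie_hausdorff : hausdorff_space G ;
  lie_second_countable : @second_countable G ;
  chart_dom : G -> set G ;
  chart : G -> G -> 'rV[R]_n ;
  chart_inv : G -> 'rV[R]_n -> G ;
  chart_dom_center : forall p : G, chart_dom p p ;
  open_chart_dom : forall p : G, open (chart_dom p) ;
  open_chart_image : forall p : G, open (chart p @` chart_dom p) ;
  chartK : forall p x : G, chart_dom p x -> chart_inv p (chart p x) = x ;
  chart_continuous : forall p x : G,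
    chart_dom p x -> {for x, continuous (chart p)} ;
  chart_inv_continuous : forall p x : G,
    chart_dom p x -> {for chart p x, continuous (chart_inv p)} ;
  transition_smooth : forall p q : G,
    smooth_on (chart p @` (chart_dom p `&` chart_dom q))
      (chart q \o chart_inv p) ;
  lie_mulg_continuous : continuous (fun xy : G * G => (xy.1 * xy.2)%g) ;
  lie_invg_continuous : continuous (fun x : G => (x^-1)%g) ;
  lie_mulg_smooth : forall p q r : G,
    smooth_on
      [set uv : 'rV[R]_n * 'rV[R]_n |
        [/\ (chart p @` chart_dom p) uv.1, (chart q @` chart_dom q) uv.2
          & chart_dom r (chart_inv p uv.1 * chart_inv q uv.2)%g]]
      (fun uv => chart r (chart_inv p uv.1 * chart_inv q uv.2)%g) ;
  lie_invg_smooth : forall p r : G,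
    smooth_on
      [set u : 'rV[R]_n |
        (chart p @` chart_dom p) u /\ chart_dom r ((chart_inv p u)^-1)%g]
      (fun u => chart r ((chart_inv p u)^-1)%g)
}.

#[short(type="lieGroupType")]
HB.structure Definition LieGroup (R : realType) (n : nat) :=
  {G of isLieGroup R n G & Group G & Topological G}.

Section Nilpotent.
Variable G : groupType.

Definition is_subgroup (H : set G) : Prop :=
  H 1%g /\ (forall x y : G, H x -> H y -> H (x / y)%g).

Fixpoint lower_central (i : nat) : set G :=
  if i is j.+1 then
    smallest is_subgroup [set [~ x, y]%g | x in lower_central j & y in [set: G]]
  else [set: G].

Definition nilpotent_group : Prop := exists c : nat, lower_central c = [set 1%g].

End Nilpotent.

Section Riemannian.
Variables (R : realType) (n : nat) (G : lieGroupType R n).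

(* The tangent space at p is identified with R^n through the chart centred at
   p; a Riemannian metric is given by its Gram matrix at each point in this
   identification. *)
Definition inner (g : G -> 'M[R]_n) (p : G) (v w : 'rV[R]_n) : R :=
  (v *m g p *m w^T) 0 0.

Definition tangent_map (f : G -> G) (p : G) (v : 'rV[R]_n) : 'rV[R]_n :=
  'D_v (chart (f p) \o f \o chart_inv p) (chart p p).

(* The tangent vector at q whose coordinates in the chart [chart p] are v. *)
Definition coord_vector (p q : G) (v : 'rV[R]_n) : 'rV[R]_n :=
  'D_v (chart q \o chart_inv p) (chart p q).

Definition riemannian_metric (g : G -> 'M[R]_n) : Prop :=
  [/\ forall p, (g p)^T = g p,
      forall p v, v != 0 -> 0 < inner g p v v
    & forall p v w, smooth_on (chart p @` chart_dom p)
        (fun u => let q := chart_inv p u in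
           inner g q (coord_vector p q v) (coord_vector p q w) : R^o)].

Definition left_invariant_metric (g : G -> 'M[R]_n) : Prop :=
  forall (a p : G) (v w : 'rV[R]_n),
    inner g (a * p)%g (tangent_map ( *%g a) p v) (tangent_map ( *%g a) p w)
    = inner g p v w.

(* C^1 on a neighbourhood of [0, 1]. *)
Definition C1_curve (gamma : R -> G) : Prop :=
  forall t : R, 0 <= t <= 1 ->
    {for t, continuous gamma} /\
    (forall p : G, chart_dom p (gamma t) ->
      (\forall s \near t, derivable (chart p \o gamma) s 1) /\
      {for t, continuous (derive1 (chart p \o gamma))}).

Definition speed (g : G -> 'M[R]_n) (gamma : R -> G) (t : R) : R :=
  let v := derive1 (chart (gamma t) \o gamma) t in
  Num.sqrt (inner g (gamma t) v v).

Definition curve_length (g : G -> 'M[R]_n) (gamma : R -> G) : \bar R :=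
  (\int[@lebesgue_measure R]_(t in `[0%R, 1%R]) (speed g gamma t)%:E)%E.

(* Piecewise C^1 paths from x to y, as finite concatenations of C^1 curves
   parametrized by [0, 1]. *)
Fixpoint piecewise_C1_path (x : G) (s : seq (R -> G)) (y : G) : Prop :=
  if s is gamma :: s' then
    [/\ C1_curve gamma, gamma 0 = x & piecewise_C1_path (gamma 1) s' y]
  else x = y.

Definition riemannian_dist (g : G -> 'M[R]_n) (x y : G) : \bar R :=
  ereal_inf [set (\sum_(gamma <- s) curve_length g gamma)%E
            | s in [set s | piecewise_C1_path x s y]].

End Riemannian.

Definition gtuple (G : Type) (k : nat) : Type := 'I_k -> G.

HB.instance Definition _ (G : topologicalType) (k : nat) :=
  Topological.copy (gtuple G k) (prod_topology (fun _ : 'I_k => G)).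

Section Diophantine.
Variables (R : realType) (n : nat) (G : lieGroupType R n).

HB.instance Definition _ (k : nat) :=
  isPointed.Build (gtuple G k) (fun=> 1%g).

(* A Haar measure on the Borel sigma-algebra of the group G^k.  As G^k is locally
   compact and second countable, regularity follows from finiteness on compact
   sets. *)
Definition haar_measure (k : nat)
    (mu : {measure set (g_sigma_algebraType (@open (gtuple G k))) -> \bar R}) :
    Prop :=
  [/\ forall (a : gtuple G k) (A : set (gtuple G k)),
        (@open (gtuple G k)).-sigma.-measurable A ->
        mu [set (fun i => (a i * x i)%g) | x in A] = mu A,
      forall K : set (gtuple G k), compact K -> (mu K < +oo)%E
    & forall U : set (gtuple G k), open U -> U !=set0 -> (0 < mu U)%E].

Definition letters (S : set G) : set G :=
  S `|` [set (x^-1)%g | x in S] `|` [set 1%g].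

(* The set (S U S^-1 U {1})^m. *)
Fixpoint word_ball (S : set G) (m : nat) : set G :=
  if m is m'.+1 then [set (x * y)%g | x in letters S & y in word_ball S m']
  else [set 1%g].

(* The infimum of the empty set is +oo. *)
Definition min_dist (g : G -> 'M[R]_n) (S : set G) (m : nat) : \bar R :=
  ereal_inf [set riemannian_dist g x 1%g | x in word_ball S m `\ 1%g].

Definition beta_diophantine (g : G -> 'M[R]_n) (beta : R) (S : set G) : Prop :=
  exists2 c : R, 0 < c & forall m : nat, (1 <= m)%N ->
    ((c * powR #|` fset_set (word_ball S m)|%:R (- beta))%:E
       <= min_dist g S m)%E.

Definition diophantine_for_tuples (g : G -> 'M[R]_n) (k : nat) : Prop :=
  exists2 beta : R, 0 < beta &
    forall mu : {measure set (g_sigma_algebraType (@open (gtuple G k))) -> \bar R},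
      haar_measure mu ->
      {ae mu, forall x : gtuple G k, beta_diophantine g beta (range x)}.

End Diophantine.

(* Main.v *)
Require Import Defs.
From HB Require Import structures.
From mathcomp Require Import all_boot all_order all_fingroup all_algebra.
From mathcomp Require Import finmap all_classical all_reals all_analysis.
From mathcomp Require Import ring lra zify measurable_realfun.
Set Implicit Arguments.
Unset Strict Implicit.
Unset Printing Implicit Defensive.
Import Order.TTheory GRing.Theory Num.Theory.
Import numFieldNormedType.Exports.
Local Open Scope classical_set_scope.
Local Open Scope ring_scope.

(** A nilpotent associative algebra A yields a connected nilpotent Lie group on
    the vector space A, with the product x + y + xy (the group 1 + A).  A group
    word in elements x_i of this group is an integer noncommutative polynomial
    in the x_i, which turns Diophantine questions about the group into linear
    algebra over the integers.

    Let K = k + 1 and s = k + 6.  The algebra used here is the free associative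
    algebra on K generators truncated at degree s, in which the part of degree s
    is replaced by its image under a single linear form ell.  On a product of s
    vectors of R^K, ell is a sum of terms of the form: determinant of K of the
    vectors, times a 2 x 2 minor of two others, times the first coordinates of
    the remaining three.  One of these terms carries a real coefficient alpha.

    For k elements, ell kills every monomial of degree s, since two of the K
    columns of the determinant come from the same element.  In degree below s
    the algebra is free: if the degree one parts of the k elements are linearly
    independent, the integer coefficients of lowest degree can be read off
    linearly from the value of the polynomial, so that a nonzero value has a
    coordinate bounded away from 0 ([span_gap]).  Such a k-tuple generates a
    discrete group, which is Diophantine for any exponent.  The other k-tuples
    form a null set: translating a matrix X by multiples of the identity meets
    the singular matrices finitely often ([ae_first_layer_unit]).

    For k + 1 elements x, write X, Y, Y_2, ..., Y_k for their degree one parts.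
    On a Lie polynomial of multidegree (5, 2, 1, ..., 1) the form ell takes the
    value (a + alpha b) D(x), with integers a, b that depend only on the Lie
    polynomial and with a polynomial D that depends only on x.  The Lie
    polynomials obtained by bracketing [ad_X^5 Y, Y] and [ad_X^4 Y, ad_X Y] with
    Y_2, ..., Y_k give (a, b) = (1, 0) and (0, 5) ([near_eltE]); degree 7 in X
    and Y is the first one in which two such independent values exist.  They are
    the values of two iterated group commutators c_1, c_2, which lie in the
    one-dimensional top part.  Hence c_2^q c_1^(-5p) is a word of length O(q)
    whose value is 5 (q alpha - p) D(x).  For a number alpha approximated by
    rationals faster than any exponential of the denominator
    ([super_liouville]) this defeats every exponent beta, because balls grow at
    most exponentially.  So no tuple in the nonempty open set where D is nonzero
    is Diophantine ([generic_not_diophantine]).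

    The passage between values and distances rests on two estimates:
    [dist_central_le] bounds the distance to a central element by the length of
    a straight segment, and [riemannian_dist_ge] bounds the distance from below
    by means of a function whose differential is bounded for every
    left-invariant metric.  Haar measure on tuples is constructed by integrating
    the coordinates one at a time in an order for which left translations are
    triangular ([haar_haar_measure]). *)

(** * Polynomial maps are smooth *)

Section Polynomial.
Variables (R : realType) (V : normedModType R).

(** Stated on an arbitrary normed module, so as to apply both to the group law,
    defined on a product space, and to curves. *)
Inductive polynomial_map : (V -> R) -> Prop :=
| polynomial_cst a : polynomial_map (fun=> a)
| polynomial_linear (f : V -> R) :
    linear f -> continuous f -> polynomial_map f
| polynomialD f g : polynomial_map f -> polynomial_map g ->
    polynomial_map (fun x => f x + g x)
| polynomialM f g : polynomial_map f -> polynomial_map g ->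
    polynomial_map (fun x => f x * g x).

Lemma linear_derivable (W : normedModType R) (f : V -> W) x v :
  linear f -> continuous f -> derivable f x v /\ 'D_v f x = f v.
Proof.
move=> lf cf; pose F : {linear V -> W} :=
  HB.pack f (GRing.isLinear.Build _ _ _ _ f lf).
have dF : differentiable F x by exact: linear_differentiable.
split; first exact: (@diff_derivable _ _ _ F x v dF).
by rewrite (deriveE _ dF) (diff_lin _ (cf : continuous F)).
Qed.

(** The difference quotients of [f] and of its linear part coincide. *)
Lemma affine_derivable (W : normedModType R) (f h : V -> W) a x v :
  (forall y, f y = a + h y) -> linear h -> continuous h ->
  derivable f x v /\ 'D_v f x = h v.
Proof.
move=> fE lh ch; have [dh Dh] := linear_derivable x v lh ch.
have qE : (fun t : R => t^-1 *: ((f \o shift x) (t *: v) - f x)) =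
          (fun t : R => t^-1 *: ((h \o shift x) (t *: v) - h x)).
  have fB y z : f y - f z = h y - h z.
    by rewrite !fE opprD addrACA subrr add0r.
  by apply/funext => t; congr (_ *: _); exact: fB.
by split; [rewrite /derivable qE|rewrite /derive qE -Dh].
Qed.

Lemma polynomial_sum (I : Type) (r : seq I) (P : pred I) (F : I -> V -> R) :
  (forall i, polynomial_map (F i)) ->
  polynomial_map (fun x => \sum_(i <- r | P i) F i x).
Proof.
move=> pF; elim: r => [|i r ih].
  by under eq_fun do rewrite big_nil; exact: polynomial_cst.
under eq_fun do rewrite big_cons; case: (P i) => //.
exact: polynomialD.
Qed.

Lemma polynomial_continuous f : polynomial_map f -> continuous f.
Proof.
elim=> [a x|g _ cg //|g h _ cg _ ch x|g h _ cg _ ch x].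
- exact: cvg_cst.
- by apply: cvgD; [exact: cg|exact: ch].
- by apply: cvgM; [exact: cg|exact: ch].
Qed.

Lemma polynomial_derivable f x v : polynomial_map f -> derivable f x v.
Proof.
elim=> [a|g lg cg|g h _ dg _ dh|g h _ dg _ dh].
- exact: derivable_cst.
- exact: (linear_derivable x v lg cg).1.
- exact: derivableD.
- exact: derivableM.
Qed.

Lemma polynomial_derive f v :
  polynomial_map f -> polynomial_map (fun x => 'D_v f x).
Proof.
elim=> [a|g lg cg|g h pg dg ph dh|g h pg dg ph dh].
- by under eq_fun do rewrite derive_cst; exact: polynomial_cst.
- rewrite (_ : (fun x => 'D_v g x) = fun=> g v); first exact: polynomial_cst.
  by apply/funext => x; exact: (linear_derivable x v lg cg).2.
- rewrite (_ : (fun x => _) = fun x => 'D_v g x + 'D_v h x).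
    exact: polynomialD.
  by apply/funext => x; rewrite deriveD//; exact: polynomial_derivable.
- rewrite (_ : (fun x => _) = fun x => g x * 'D_v h x + h x * 'D_v g x).
    by apply: polynomialD; exact: polynomialM.
  by apply/funext => x; rewrite deriveM//; exact: polynomial_derivable.
Qed.

Variable n : nat.

Lemma row_norm_le (x : 'rV[R]_n) e : 0 <= e ->
  (`|x| <= e) <-> (forall j, `|x 0 j| <= e).
Proof.
move=> e0; rewrite /Num.Def.normr/= mx_normrE; split=> [xe j|xe].
  by apply: le_trans xe; rewrite (le_bigmax _ (fun i => `|x i.1 i.2|) (0, j)).
by apply: bigmax_le => // -[i j] _; rewrite ord1 xe.
Qed.

Lemma row_norm_lt (x : 'rV[R]_n) e : 0 < e ->
  (`|x| < e) <-> (forall j, `|x 0 j| < e).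
Proof.
move=> e0; rewrite /Num.Def.normr/= mx_normrE; split=> [xe j|xe].
  by apply: le_lt_trans xe; rewrite (le_bigmax _ (fun i => `|x i.1 i.2|) (0, j)).
by apply/bigmax_ltP; split=> // -[i j] _; rewrite ord1 xe.
Qed.

Lemma row_continuous (f : V -> 'rV[R]_n) x :
  (forall j, {for x, continuous (fun y => f y 0 j)}) -> {for x, continuous f}.
Proof.
move=> cf; apply/cvgrPdist_le => /= e e0.
near=> y.
rewrite /Num.Def.normr/= mx_normrE (bigmax_le _ (ltW e0))//= => -[i j] _.
rewrite !mxE/= ord1; move: j; near: y; apply: filter_forall => j.
exact: ((cvgrPdist_le _ _).1 (cf j)).
Unshelve. all: by end_near. Qed.

Definition polynomial_row (f : V -> 'rV[R]_n) :=
  forall j, polynomial_map (fun x => f x 0 j).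

Lemma polynomial_row_derivable f x v : polynomial_row f -> derivable f x v.
Proof.
by move=> pf; apply/derivable_mxP => i j; rewrite ord1; exact: polynomial_derivable.
Qed.

Lemma polynomial_row_derive f v :
  polynomial_row f -> polynomial_row (fun x => 'D_v f x).
Proof.
move=> pf j.
under eq_fun do (rewrite derive_mx ?mxE; last exact: polynomial_row_derivable).
exact: polynomial_derive.
Qed.

(** Directional derivatives of polynomial maps are again polynomial maps. *)
Lemma polynomial_row_smooth A f : polynomial_row f -> smooth_on A f.
Proof.
move=> pf vs; have : polynomial_row (iter_derive vs f).
  by elim: vs => [//|v vs ih] /=; exact: polynomial_row_derive.
move: (iter_derive vs f) => h ph x _; split=> [|v].
  by apply: row_continuous => j; exact: polynomial_continuous.
exact: polynomial_row_derivable.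
Qed.

End Polynomial.

(** * Nilpotent associative algebras and their groups *)

(** A finite dimensional algebra given by structure constants in a basis whose
    elements have degrees; products do not decrease the total degree, hence the
    algebra is nilpotent. *)
Record nilalg (R : realType) := NilAlg {
  adim : nat;
  adeg : 'I_adim -> nat;
  step : nat;
  acst : 'I_adim -> 'I_adim -> 'I_adim -> R;
  adeg_gt0 : forall i, (0 < adeg i)%N;
  adeg_le_step : forall i, (adeg i <= step)%N;
  acst_deg : forall i j l, acst i j l != 0 -> (adeg j + adeg l <= adeg i)%N;
  acstA : forall i u v w,
    \sum_j acst i j w * acst j u v = \sum_j acst i u j * acst j v w
}.

Section NilpotentAlgebra.
Variables (R : realType) (A : nilalg R).
Local Notation vec := 'rV[R]_(adim A).
Local Notation c := (@acst R A).
Local Notation deg := (@adeg R A).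
Implicit Types x y z : vec.

Definition amul x y : vec :=
  \row_i \sum_j \sum_l c i j l * (x 0 j * y 0 l).

Lemma amulDl x y z : amul (x + y) z = amul x z + amul y z.
Proof.
apply/rowP => i; rewrite !mxE -big_split; apply: eq_bigr => j _.
by rewrite -big_split; apply: eq_bigr => l _; rewrite mxE mulrDl mulrDr.
Qed.

Lemma amulDr x y z : amul x (y + z) = amul x y + amul x z.
Proof.
apply/rowP => i; rewrite !mxE -big_split; apply: eq_bigr => j _.
by rewrite -big_split; apply: eq_bigr => l _; rewrite mxE mulrDr mulrDr.
Qed.

Lemma amulZl a x y : amul (a *: x) y = a *: amul x y.
Proof.
apply/rowP => i; rewrite !mxE mulr_sumr; apply: eq_bigr => j _.
by rewrite mulr_sumr; apply: eq_bigr => l _; rewrite mxE -mulrA mulrCA.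
Qed.

Lemma amulZr a x y : amul x (a *: y) = a *: amul x y.
Proof.
apply/rowP => i; rewrite !mxE mulr_sumr; apply: eq_bigr => j _.
rewrite mulr_sumr; apply: eq_bigr => l _.
by rewrite mxE (mulrCA (x 0 j)) [LHS]mulrCA.
Qed.

Lemma amul0l x : amul 0 x = 0.
Proof. by rewrite -[X in amul X _](scale0r x) amulZl scale0r. Qed.

Lemma amul0r x : amul x 0 = 0.
Proof. by rewrite -[X in amul _ X](scale0r x) amulZr scale0r. Qed.

Lemma amulNl x y : amul (- x) y = - amul x y.
Proof. by rewrite -scaleN1r amulZl scaleN1r. Qed.

Lemma amulNr x y : amul x (- y) = - amul x y.
Proof. by rewrite -scaleN1r amulZr scaleN1r. Qed.

Lemma amulBr x y z : amul x (y - z) = amul x y - amul x z.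
Proof. by rewrite amulDr amulNr. Qed.

Lemma amul_suml (I : Type) (r : seq I) (F : I -> vec) y :
  amul (\sum_(i <- r) F i) y = \sum_(i <- r) amul (F i) y.
Proof.
by elim/big_rec2: _ => [|i u v _ <-]; rewrite ?amul0l// amulDl.
Qed.

Lemma amul_sumr (I : Type) (r : seq I) (F : I -> vec) x :
  amul x (\sum_(i <- r) F i) = \sum_(i <- r) amul x (F i).
Proof.
by elim/big_rec2: _ => [|i u v _ <-]; rewrite ?amul0r// amulDr.
Qed.

Lemma amulA x y z : amul x (amul y z) = amul (amul x y) z.
Proof.
apply/rowP => i; rewrite !mxE.
transitivity (\sum_u \sum_v \sum_w
    (\sum_j c i u j * c j v w) * (x 0 u * y 0 v * z 0 w)).
  apply: eq_bigr => u _.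
  transitivity (\sum_j \sum_v \sum_w
      c i u j * c j v w * (x 0 u * y 0 v * z 0 w)).
    apply: eq_bigr => j _; rewrite mxE !mulr_sumr; apply: eq_bigr => v _.
    rewrite !mulr_sumr; apply: eq_bigr => w _.
    by rewrite (mulrCA (x 0 u)) !mulrA.
  rewrite exchange_big; apply: eq_bigr => v _.
  by rewrite exchange_big; apply: eq_bigr => w _; rewrite mulr_suml.
apply/esym.
transitivity (\sum_j \sum_w \sum_u \sum_v
    c i j w * c j u v * (x 0 u * y 0 v * z 0 w)).
  apply: eq_bigr => j _; apply: eq_bigr => w _.
  rewrite mxE mulr_suml mulr_sumr; apply: eq_bigr => u _.
  rewrite mulr_suml mulr_sumr; apply: eq_bigr => v _.
  by rewrite !mulrA.
rewrite exchange_big /=.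
under eq_bigr => w _ do rewrite exchange_big /=.
rewrite exchange_big /=; apply: eq_bigr => u _.
under eq_bigr => w _ do rewrite exchange_big /=.
rewrite exchange_big /=; apply: eq_bigr => v _.
apply: eq_bigr => w _.
by rewrite -mulr_suml acstA.
Qed.

(** The filtration by the ideals of elements of degree at least [m]. *)
Definition filt m : set vec := [set x | forall i, (deg i < m)%N -> x 0 i = 0].

Lemma filt0 m : filt m 0. Proof. by move=> i _; rewrite mxE. Qed.

Lemma filtD m x y : filt m x -> filt m y -> filt m (x + y).
Proof. by move=> fx fy i im; rewrite mxE fx// fy// addr0. Qed.

Lemma filtN m x : filt m x -> filt m (- x).
Proof. by move=> fx i im; rewrite mxE fx// oppr0. Qed.

Lemma filtB m x y : filt m x -> filt m y -> filt m (x - y).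
Proof. by move=> fx fy; apply: filtD => //; exact: filtN. Qed.

Lemma filtZ m a x : filt m x -> filt m (a *: x).
Proof. by move=> fx i im; rewrite mxE fx// mulr0. Qed.

Lemma filt1 x : filt 1 x.
Proof. by move=> i; rewrite ltnS leqNgt adeg_gt0. Qed.

Lemma filt_le m p x : (p <= m)%N -> filt m x -> filt p x.
Proof. by move=> pm fx i ip; apply: fx; exact: leq_trans pm. Qed.

Lemma filt_step x : filt (step A).+1 x -> x = 0.
Proof.
by move=> fx; apply/rowP => i; rewrite fx ?mxE// ltnS adeg_le_step.
Qed.

Lemma filtM m p x y : filt m x -> filt p y -> filt (m + p) (amul x y).
Proof.
move=> fx fy i imp; rewrite mxE big1// => j _; rewrite big1// => l _.
have [->|c0] := eqVneq (c i j l) 0; first by rewrite mul0r.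
have jl := acst_deg c0.
have [jm|mj] := ltnP (deg j) m; first by rewrite fx// mul0r mulr0.
rewrite fy ?mulr0//.
rewrite -(ltn_add2l m) (leq_trans _ imp)// ltnS (leq_trans _ jl)//.
by rewrite leq_add2r.
Qed.

Definition gmul x y : vec := x + y + amul x y.

(** The partial sums of - x + x^2 - x^3 + ..., the circle inverse of x; they are
    stationary once the step is reached. *)
Fixpoint partial_inverse m x : vec :=
  if m is p.+1 then - x - amul x (partial_inverse p x) else 0.

Definition ginv x : vec := partial_inverse (step A) x.

Lemma gmulA : associative gmul.
Proof.
move=> x y z; rewrite /gmul !amulDl !amulDr amulA !addrA.
by rewrite [LHS](ACl (1*2*5*3*6*4*7))%AC.
Qed.

Lemma gmul0r : right_id 0 gmul.
Proof. by move=> x; rewrite /gmul amul0r !addr0. Qed.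

Lemma gmul0l : left_id 0 gmul.
Proof. by move=> x; rewrite /gmul amul0l addr0 add0r. Qed.

(** The difference of consecutive partial sums is a signed power of [x]. *)
Lemma partial_inverse_filt m x :
  filt m.+1 (partial_inverse m.+1 x - partial_inverse m x).
Proof.
elim: m => [|m ih]; first exact: filt1.
have -> : partial_inverse m.+2 x - partial_inverse m.+1 x =
    - amul x (partial_inverse m.+1 x - partial_inverse m x).
  have -> : partial_inverse m.+2 x = - x - amul x (partial_inverse m.+1 x) by [].
  rewrite amulBr; move: (amul x (partial_inverse m.+1 x)) => u /=.
  move: (amul x (partial_inverse m x)) => v.
  by rewrite opprB opprB opprK [v + x]addrC addrACA addNr add0r addrC.
by rewrite -add1n; apply: filtN; apply: filtM => //; exact: filt1.
Qed.

Lemma gmulV : right_inverse 0 ginv gmul.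
Proof.
move=> x; have /filt_step := @partial_inverse_filt (step A) x.
move/eqP; rewrite subr_eq add0r /gmul /ginv => /eqP {1}<-.
by rewrite [partial_inverse _.+1 x]/= addrA subrr add0r addNr.
Qed.

Lemma gmulVl : left_inverse 0 ginv gmul.
Proof.
move=> x; rewrite -[LHS]gmul0r -{1}(gmulV (ginv x)) gmulA.
by rewrite -(gmulA _ x) gmulV gmul0r gmulV.
Qed.

End NilpotentAlgebra.

(** * The Lie group of a nilpotent algebra *)

Section RowSpace.
Variables (R : realType) (n : nat).
Local Notation vec := 'rV[R]_n.

Lemma row_second_countable : @second_countable vec.
Proof.
exists (range (fun qe : 'rV[rat]_n * rat =>
  ball (map_mx ratr qe.1 : vec) (ratr qe.2))).
  exact: sub_countable (card_image_le _ _) (countableP _).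
split=> [_ [qe _ <-]|x]; first exact: ball_open.
move=> U /nbhs_ballP[e /= e0 eU].
have /rat_in_itvoo[r] : 0 < e / 2 by rewrite divr_gt0.
rewrite in_itv/= => /andP[r0 re].
have qx j : exists q : rat, `|x 0 j - ratr q| < ratr r.
  have /rat_in_itvoo[q] : x 0 j - ratr r < x 0 j + ratr r.
    by rewrite ltrD2l gtrN.
  by rewrite in_itv/= => qr; exists q; rewrite distrC ltr_distl.
exists (ball (map_mx ratr (\row_j sval (cid (qx j))) : vec) (ratr r)).
  split; first by exists (\row_j sval (cid (qx j)), r).
  rewrite -ball_normE/= distrC; apply/row_norm_lt => // j.
  by rewrite !mxE; exact: svalP (cid (qx j)).
move=> y; rewrite -ball_normE/= => yr; apply: eU; rewrite -ball_normE/=.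
rewrite -(subrKA (map_mx ratr (\row_j sval (cid (qx j))))).
apply: le_lt_trans (ler_normD _ _) _; rewrite (splitr e) ltrD//.
  apply: lt_trans re; apply/row_norm_lt => // j.
  by rewrite !mxE; exact: svalP (cid (qx j)).
by apply: lt_trans re.
Qed.

Lemma row_connected : connected [set: vec].
Proof.
have -> : [set: vec] = \bigcup_(x in [set: vec]) ((fun t : R => t *: x) @` `[0, 1]).
  apply/seteqP; split=> // x _; exists x => //; exists 1; rewrite ?scale1r//.
  by rewrite /= in_itv/= lexx ler01.
apply: bigcup_connected.
  by exists 0 => x _; exists 0; rewrite ?scale0r//= in_itv/= lexx ler01.
move=> x _; apply: connected_continuous_connected; first exact: segment_connected.
by apply: continuous_subspaceT => t; exact: scalel_continuous.
Qed.

End RowSpace.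

(** A separate name for the space of row vectors, so that it can carry the group
    law without clashing with the additive structure. *)
Definition nilpotent_lie (R : realType) (A : nilalg R) : Type := 'rV[R]_(adim A).

Section NilpotentLie.
Variables (R : realType) (A : nilalg R).
Local Notation vec := 'rV[R]_(adim A).
Local Notation G := (nilpotent_lie A).

HB.instance Definition _ := Topological.copy G vec.
HB.instance Definition _ := isGroup.Build G
  (@gmulA R A) (@gmul0l R A) (@gmul0r R A) (@gmulVl R A) (@gmulV R A).

Lemma polynomial_coord (V : normedModType R) (j : 'I_(adim A)) (f : V -> vec) :
  linear f -> continuous f -> polynomial_map (fun x => f x 0 j).
Proof.
move=> lf cf; apply: polynomial_linear => [a x y|x].
  by rewrite lf !mxE.
exact: (continuous_comp (cf x) (@coord_continuous _ _ _ _ _ _)).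
Qed.

Lemma polynomial_row_linear (V : normedModType R) (f : V -> vec) :
  linear f -> continuous f -> polynomial_row f.
Proof. by move=> lf cf j; exact: polynomial_coord. Qed.

Lemma polynomial_rowD (V : normedModType R) (f g : V -> vec) :
  polynomial_row f -> polynomial_row g -> polynomial_row (fun x => f x + g x).
Proof.
by move=> pf pg j; under eq_fun do rewrite mxE; exact: polynomialD.
Qed.

Lemma polynomial_rowN (V : normedModType R) (f : V -> vec) :
  polynomial_row f -> polynomial_row (fun x => - f x).
Proof.
move=> pf j; under eq_fun do rewrite mxE -mulN1r.
by apply: polynomialM => //; exact: polynomial_cst.
Qed.

Lemma polynomial_amul (V : normedModType R) (f g : V -> vec) :
  polynomial_row f -> polynomial_row g ->
  polynomial_row (fun x => amul (f x) (g x)).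
Proof.
move=> pf pg j; under eq_fun do rewrite mxE.
apply: polynomial_sum => u; apply: polynomial_sum => v.
by apply: polynomialM; [exact: polynomial_cst|exact: polynomialM].
Qed.

Lemma polynomial_gmul : polynomial_row (fun xy : vec * vec => gmul xy.1 xy.2).
Proof.
have p1 : polynomial_row (fun xy : vec * vec => xy.1).
  by apply: polynomial_row_linear => // x; exact: cvg_fst.
have p2 : polynomial_row (fun xy : vec * vec => xy.2).
  by apply: polynomial_row_linear => // x; exact: cvg_snd.
apply: polynomial_rowD; last exact: polynomial_amul.
exact: polynomial_rowD.
Qed.

Lemma polynomial_ginv : polynomial_row (@ginv R A).
Proof.
have pid : polynomial_row (fun x : vec => x).
  by apply: polynomial_row_linear => // x; exact: cvg_id.
rewrite /ginv; elim: (step A) => [|m ih] /=.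
  by move=> j; under eq_fun do rewrite mxE; exact: polynomial_cst.
apply: polynomial_rowD; first exact: polynomial_rowN.
by apply: polynomial_rowN; exact: polynomial_amul.
Qed.

Lemma polynomial_row_continuous (V : normedModType R) (f : V -> vec) :
  polynomial_row f -> continuous f.
Proof.
by move=> pf x; apply: row_continuous => j; exact: polynomial_continuous.
Qed.

Let chart_dom_center (p : G) : [set: G] p. Proof. by []. Qed.
Let chart_open (p : G) : open [set: G]. Proof. exact: openT. Qed.
Let chart_image_open (p : G) : open ((id : G -> vec) @` [set: G]).
Proof. by rewrite image_id; exact: openT. Qed.
Let chart_cancel (p x : G) : [set: G] x -> (id : vec -> G) ((id : G -> vec) x) = x.
Proof. by []. Qed.
Let chart_cont (p x : G) : [set: G] x -> {for x, continuous (id : G -> vec)}.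
Proof. by move=> _; exact: cvg_id. Qed.
Let chart_inv_cont (p x : G) :
  [set: G] x -> {for (id : G -> vec) x, continuous (id : vec -> G)}.
Proof. by move=> _; exact: cvg_id. Qed.
Let transition (p q : G) :
  smooth_on ((id : G -> vec) @` ([set: G] `&` [set: G]))
    ((id : G -> vec) \o (id : vec -> G)).
Proof.
apply: polynomial_row_smooth; apply: polynomial_row_linear => //.
by move=> x; exact: cvg_id.
Qed.
Let mul_cont : continuous (fun xy : G * G => (xy.1 * xy.2)%g).
Proof. exact: (polynomial_row_continuous polynomial_gmul). Qed.
Let inv_cont : continuous (fun x : G => (x^-1)%g).
Proof. exact: (polynomial_row_continuous polynomial_ginv). Qed.

HB.instance Definition _ := isLieGroup.Build R (adim A) G
  (@norm_hausdorff _ _) (@row_second_countable R (adim A))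
  chart_dom_center chart_open chart_image_open chart_cancel
  chart_cont chart_inv_cont transition mul_cont inv_cont
  (fun _ _ _ => polynomial_row_smooth polynomial_gmul)
  (fun _ _ => polynomial_row_smooth polynomial_ginv).

End NilpotentLie.

(** * Nilpotency of the group *)

Section GroupNilpotent.
Variables (R : realType) (A : nilalg R).
Local Notation vec := 'rV[R]_(adim A).
Local Notation G := (nilpotent_lie A).

Lemma lie_mulgE (x y : G) : (x * y)%g = gmul (x : vec) y.
Proof. by []. Qed.

Lemma lie_1gE : (1%g : G) = (0 : vec).
Proof. by []. Qed.

Lemma filt_gmul m (x y : vec) : (0 < m)%N ->
  filt m x -> filt m y -> filt m (gmul x y).
Proof.
move=> m0 fx fy; apply: filtD; first exact: filtD.
by apply: (@filt_le _ _ (m + m)); [exact: leq_addr|exact: filtM].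
Qed.

Lemma filt_ginv m (x : vec) : filt m x -> filt m (ginv x).
Proof.
move=> fx; rewrite /ginv; elim: (step A) => [|p ih] /=; first exact: filt0.
apply: filtB; first exact: filtN.
by apply: (@filt_le _ _ (m + m)); [exact: leq_addr|exact: filtM].
Qed.

(** With d = xy - yx, the commutator c satisfies c = d - (y * x) c, where * is
    the group law; multiplying by y * x raises the degree, so c and d agree up to
    higher degree. *)
Lemma filt_commg i j (x y : G) :
  filt i (x : vec) -> filt j (y : vec) ->
  filt (i + j).+1 (([~ x, y]%g : vec) - (amul (x : vec) y - amul (y : vec) x)).
Proof.
move=> fx fy; set c := [~ x, y]%g; set d := amul (x : vec) y - _.
have fd : filt (i + j) d.
  by apply: filtB; [|rewrite addnC]; exact: filtM.
have cE : (c : vec) - d = - amul (gmul (y : vec) x) c.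
  have h : gmul (x : vec) y = gmul (y : vec) x + c + amul (gmul (y : vec) x) c.
    by have := commgC x y; rewrite !lie_mulgE.
  rewrite /d; move: {d fd} (c : vec) h => {}c.
  rewrite {1 2}/gmul; move: (amul (gmul _ _) _) => u.
  move: (amul (x : vec) y) (amul (y : vec) x) => v w h.
  have -> : v = c + u + w.
    apply: (addrI ((x : vec) + y)); rewrite h (addrC (x : vec)).
    by rewrite -!addrA; congr (_ + (_ + _)); rewrite addrC -addrA.
  by rewrite addrK opprD addrA subrr add0r.
(* The degree of c is pushed up one step at a time to that of d. *)
have fc m : (m <= i + j)%N -> filt m c.
  elim: m => [_ k|m ih mij]; first by rewrite ltn0.
  rewrite -[c : vec](subrK d); apply: filtD; last exact: filt_le fd.
  rewrite cE; apply: filtN; rewrite -add1n; apply: filtM; first exact: filt1.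
  by apply: ih; exact: ltnW.
by rewrite cE -add1n; apply: filtN; apply: filtM; [exact: filt1|exact: fc].
Qed.

Lemma filt_subgroup m : (0 < m)%N -> is_subgroup (filt m : set G).
Proof.
move=> m0; split=> [|x y fx fy]; first exact: filt0.
by apply: filt_gmul => //; exact: filt_ginv.
Qed.

Lemma lower_central1 (H : groupType) i : @lower_central H i 1%g.
Proof. by case: i => [//|i] /=; move=> K [[]]. Qed.

Lemma nilpotent_lieP : nilpotent_group G.
Proof.
exists (step A).
have lcf i : @lower_central G i `<=` (filt i.+1 : set G).
  elim: i => [x _|i ih /=]; first exact: filt1.
  apply: smallest_sub; first exact: filt_subgroup.
  move=> _ [x /ih fx [y _ <-]] /=.
  rewrite -[X in filt _ X](subrK (amul (x : vec) y - amul (y : vec) x)).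
  have := filt_commg fx (filt1 (y : vec)); rewrite addn1 => h.
  apply: filtD; first exact: filt_le h.
  apply: filtB; [rewrite -[i.+2]addn1|rewrite -[i.+2]add1n];
    apply: filtM => //; exact: filt1.
apply/seteqP; split=> [x /lcf /filt_step -> //|_ ->].
exact: lower_central1.
Qed.

End GroupNilpotent.

(** * Left-invariant metrics in coordinates *)

Section Metric.
Variables (R : realType) (A : nilalg R).
Local Notation vec := 'rV[R]_(adim A).
Local Notation G := (nilpotent_lie A).

Lemma coord_norm n (x : 'rV[R]_n) j : `|x 0 j| <= `|x|.
Proof. by move: j; apply/row_norm_le. Qed.

Lemma amul_bound : exists2 C : R, 0 < C &
  forall x y : vec, `|amul x y| <= C * (`|x| * `|y|).
Proof.
pose C : R := \sum_i \sum_j \sum_l `|@acst R A i j l| + 1.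
have C0 : 0 <= \sum_i \sum_j \sum_l `|@acst R A i j l|.
  by apply: sumr_ge0 => i _; apply: sumr_ge0 => j _; apply: sumr_ge0.
exists C; first by rewrite ltr_wpDl.
move=> x y; apply/row_norm_le.
  by rewrite mulr_ge0 ?mulr_ge0// addr_ge0.
move=> i; rewrite mxE (le_trans (ler_norm_sum _ _ _))//.
apply: (@le_trans _ _ (\sum_j \sum_l `|@acst R A i j l| * (`|x| * `|y|))).
  apply: ler_sum => j _; apply: le_trans (ler_norm_sum _ _ _) _.
  apply: ler_sum => l _; rewrite normrM ler_wpM2l// normrM.
  by apply: ler_pM => //; exact: coord_norm.
under eq_bigr do rewrite -mulr_suml.
rewrite -mulr_suml ler_wpM2r ?mulr_ge0//.
apply: (@le_trans _ _ (\sum_i \sum_j \sum_l `|@acst R A i j l|)); last first.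
  by rewrite lerDl.
rewrite [leRHS](bigD1 i)//= lerDl; apply: sumr_ge0 => i' _.
by apply: sumr_ge0 => j _; apply: sumr_ge0.
Qed.

Lemma linear_amul (x : vec) : linear (amul x).
Proof. by move=> a u v; rewrite amulDr amulZr. Qed.

Lemma continuous_amul (x : vec) : continuous (amul x).
Proof.
apply: polynomial_row_continuous; apply: polynomial_amul.
  by move=> j; exact: polynomial_cst.
by apply: polynomial_row_linear => // y; exact: cvg_id.
Qed.

Lemma coord_vectorE (p q : G) (v : vec) : coord_vector p q v = v.
Proof. exact: derive_id. Qed.

Lemma derive_gmul (a p v : vec) : 'D_v (gmul a) p = v + amul a v.
Proof.
pose f (y : vec) : vec := y + amul a y.
have lf : linear f.
  by move=> k x y; rewrite /f amulDr amulZr addrACA scalerDr.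
have cf : continuous f.
  apply: polynomial_row_continuous; apply: polynomial_rowD.
    by apply: polynomial_row_linear => // y; exact: cvg_id.
  apply: polynomial_row_linear; [exact: linear_amul|exact: continuous_amul].
have gE y : gmul a y = a + f y by rewrite /gmul /f addrA.
exact: (affine_derivable p v gE lf cf).2.
Qed.

Lemma tangent_mapE (a p : G) (v : vec) :
  tangent_map ( *%g a) p v = v + amul (a : vec) v.
Proof. exact: derive_gmul. Qed.

(** The velocity u at p transported to the identity by left translation. *)
Definition body_velocity (p : G) (u : vec) : vec := u + amul (ginv (p : vec)) u.

Lemma body_velocityK (p : G) (u : vec) :
  body_velocity p u + amul (p : vec) (body_velocity p u) = u.
Proof.
have h := gmulV (p : vec); rewrite /gmul in h.
rewrite /body_velocity amulDr amulA -[RHS]addr0 -(amul0l u) -h !amulDl -!addrA.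
by congr (_ + _); rewrite addrCA.
Qed.

Variable g : G -> 'M[R]_(adim A).
Hypothesis gR : riemannian_metric g.
Hypothesis gL : left_invariant_metric g.

Lemma inner_translate (p : G) (v : vec) :
  inner g p (v + amul (p : vec) v) (v + amul (p : vec) v) = inner g 1%g v v.
Proof.
by have := gL p 1%g v v; rewrite !tangent_mapE mulg1.
Qed.

Lemma innerE (p : G) (u v : vec) :
  inner g p u v = \sum_i \sum_j u 0 j * g p j i * v 0 i.
Proof.
rewrite /inner mxE; apply: eq_bigr => i _.
by rewrite !mxE mulr_suml.
Qed.

Lemma continuous_metric_coef i j : continuous (fun p : vec => g (p : G) i j).
Proof.
case: gR => _ _ gs p.
have [+ _] := @gs p (delta_mx 0 i) (delta_mx 0 j) [::] (p : vec) (ex_intro2 _ _ p I erefl).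
rewrite /=.
rewrite (_ : (fun u => _) = (fun q : vec => g (q : G) i j) :> (vec -> R))//.
apply/funext => q; rewrite !coord_vectorE innerE.
rewrite (bigD1 j)//= (bigD1 i)//= big1 => [|l li]; last first.
  by rewrite mxE (negbTE li) andbF !mul0r.
rewrite big1 => [|l lj].
  by rewrite !mxE !eqxx/= mul1r mulr1 !addr0.
by apply: big1 => k _; rewrite [X in _ * X]mxE (negbTE lj) andbF mulr0.
Qed.

Lemma innerZ (p : G) a (v : vec) :
  inner g p (a *: v) (a *: v) = a ^+ 2 * inner g p v v.
Proof.
rewrite !innerE mulr_sumr; apply: eq_bigr => i _; rewrite mulr_sumr.
by apply: eq_bigr => j _; rewrite !mxE; ring.
Qed.

(** Compactness of the unit sphere. *)
Lemma inner1_bound : exists2 m : R, 0 < m &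
  forall v : vec, m * `|v| <= Num.sqrt (inner g 1%g v v).
Proof.
case: (gR) => _ gp _.
pose S := [set v : vec | `|v| = 1].
have [[v0 Sv0]|S0] := pselect (S !=set0); last first.
- exists 1 => // v; rewrite mul1r.
  have [->|v0] := eqVneq v 0; first by rewrite normr0 sqrtr_ge0.
  exfalso; apply: S0; exists (`|v|^-1 *: v).
  by rewrite /S/= normrZ normfV normr_id mulVf// normr_eq0.
- have cS : compact S.
    apply: bounded_closed_compact.
      by exists 1; split; [exact: num_real|move=> e e1 v/= ->; exact: ltW].
    rewrite (_ : S = (fun v : vec => `|v|) @^-1` [set 1])//.
    by apply: closed_comp; [move=> v _; exact: norm_continuous|exact: closed_eq].
  have ci : continuous (fun v : vec => inner g 1%g v v : R).
    rewrite (_ : (fun v => _) = fun v : vec =>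
      \sum_i \sum_j v 0 j * g (1%g : G) j i * v 0 i); last first.
      by apply/funext => v; rewrite innerE.
    apply: polynomial_continuous; apply: polynomial_sum => i.
    apply: polynomial_sum => j; have pc l : polynomial_map (fun v : vec => v 0 l).
      by apply: polynomial_coord => // v; exact: cvg_id.
    by apply: polynomialM => //; apply: polynomialM => //; exact: polynomial_cst.
  have [c] := @compact_EVT_min _ _ _ _ (ex_intro _ v0 Sv0) cS
    (continuous_subspaceT ci).
  rewrite inE => Sc cmin.
  have c0 : c != 0.
    by apply/eqP => c0; move: Sc; rewrite /S/= c0 normr0 => /esym/eqP; rewrite oner_eq0.
  exists (Num.sqrt (inner g 1%g c c)); first by rewrite sqrtr_gt0 gp.
  move=> v; have [->|vn0] := eqVneq v 0.
    by rewrite normr0 mulr0 sqrtr_ge0.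
  have nv0 : 0 < `|v| by rewrite normr_gt0.
  have vE : v = `|v| *: (`|v|^-1 *: v) by rewrite scalerA mulfV ?gt_eqF// scale1r.
  rewrite [in leRHS]vE.
  rewrite innerZ sqrtrM ?sqr_ge0// sqrtr_sqr normr_id mulrC ler_wpM2l//.
  apply: ler_wsqrtr.
  by apply: cmin; rewrite inE /S/= normrZ normfV normr_id mulVf// gt_eqF.
Qed.


Lemma inner_central (p : G) (x : vec) : filt (step A) x ->
  inner g p x x = inner g 1%g x x.
Proof.
move=> fx; rewrite -(inner_translate p).
have -> : amul (p : vec) x = 0.
  by apply: filt_step; rewrite -add1n; apply: filtM => //; exact: filt1.
by rewrite addr0.
Qed.

(** Left translations fix the direction of a central vector, so the segment from
    [x] to the identity has constant speed. *)
Lemma dist_central_le (x : vec) : filt (step A) x ->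
  (riemannian_dist g (x : G) 1%g <= (Num.sqrt (inner g 1%g x x))%:E)%E.
Proof.
move=> fx; pose gamma (t : R) : G := (x + t *: - x : vec).
have lx : linear (fun t : R => t *: - x).
  by move=> a s t; rewrite scalerDl scalerA.
have dgamma (t : R) : derivable (gamma : R -> vec) t 1 /\
    'D_1 (gamma : R -> vec) t = - x.
  have [] := @affine_derivable R R _ gamma _ x t 1 (fun=> erefl) lx
    (@scalel_continuous _ _ (- x)).
  by rewrite scale1r.
have cgamma : continuous (gamma : R -> vec).
  move=> t; apply: cvgD; first exact: cvg_cst.
  exact: scalel_continuous.
have gamma'E (p : G) : derive1 ((chart p : G -> vec) \o gamma) = cst (- x).
  by apply/funext => t; rewrite derive1E; exact: (dgamma t).2.
apply: ge_ereal_inf; exists (\sum_(c <- [:: gamma]) curve_length g c)%E.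
  exists [:: gamma] => //; split; last 2 first.
  + by rewrite /gamma scale0r addr0.
  + by rewrite /= /gamma scale1r subrr.
  + move=> t _; split; first exact: cgamma.
    move=> p _; split; first by apply: (@filterE _ (nbhs t)) => s; exact: (dgamma s).1.
    by rewrite gamma'E; exact: cst_continuous.
rewrite big_cons big_nil adde0 /curve_length.
  rewrite (_ : (fun t => _) = cst (Num.sqrt (inner g 1%g x x))%:E); last first.
    apply/funext => t; rewrite /speed gamma'E /= -scaleN1r innerZ sqrrN expr1n mul1r.
    by rewrite inner_central.
  rewrite integral_cst//= lebesgue_measure_itv/= lte_fin ltr01 oppr0 adde0.
  by rewrite mule1.
Qed.

Definition sqnorm (x : vec) : R := \sum_j x 0 j ^+ 2.

Lemma sqnorm_ge0 x : 0 <= sqnorm x.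
Proof. by apply: sumr_ge0 => j _; exact: sqr_ge0. Qed.

Lemma sqr_norm_le_sqnorm (x : vec) : `|x| ^+ 2 <= sqnorm x.
Proof.
suff : `|x| <= Num.sqrt (sqnorm x).
  by rewrite -(ler_pXn2r (ltn0Sn 1)) ?nnegrE ?sqrtr_ge0// sqr_sqrtr// sqnorm_ge0.
apply/row_norm_le; first exact: sqrtr_ge0.
move=> j; rewrite -sqrtr_sqr ler_sqrt ?sqnorm_ge0// /sqnorm (bigD1 j)//= lerDl.
by apply: sumr_ge0 => i _; exact: sqr_ge0.
Qed.

(** The differential of 1 / (1 + |p|^2) at p, applied to u = v + pv with v the
    body velocity, is at most a constant times (|p| + |p|^2) |v| / (1 + |p|^2)^2,
    and hence is bounded by the norm of v. *)
Lemma speed_bound : exists2 K : R, 0 < K & forall (p : G) (u : vec),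
  `|(1 + sqnorm (p : vec)) ^- 2 * \sum_j 2 * (p : vec) 0 j * u 0 j|
     <= K * Num.sqrt (inner g p u u).
Proof.
have [C C0 mC] := amul_bound; have [m m0 im] := inner1_bound.
pose D := 2 * (adim A)%:R * (1 + C) : R.
have D0 : 0 <= D by rewrite !mulr_ge0// addr_ge0// ltW.
exists ((D + 1) / m); first by rewrite divr_gt0// ltr_wpDl.
move=> p u; set v := body_velocity p u.
have uE : v + amul (p : vec) v = u by exact: body_velocityK.
have sE : inner g p u u = inner g 1%g v v by rewrite -uE inner_translate.
have S1 : 1 <= 1 + sqnorm (p : vec) by rewrite lerDl sqnorm_ge0.
have S0 : 0 < 1 + sqnorm (p : vec) by rewrite (lt_le_trans _ S1).
have pS := sqr_norm_le_sqnorm (p : vec).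
have uv : `|u| <= (1 + C * `|p : vec|) * `|v|.
  by rewrite -{1}uE (le_trans (ler_normD _ _))// mulrDl mul1r lerD2l -mulrA mC.
have pC : `|p : vec| * (1 + C * `|p : vec|) <= (1 + C) * (1 + sqnorm (p : vec)).
  have := normr_ge0 (p : vec); move: pS; clear -C0.
  move: (sqnorm (p : vec)) (`|p : vec|) => s N Ns N0; have s0 : 0 <= s by rewrite (le_trans _ Ns)// sqr_ge0.
  rewrite (_ : N * _ = N + C * N ^+ 2); last by ring.
  rewrite mulrDl mul1r lerD//; first by nra.
  by rewrite ler_pM2l//; lra.
rewrite sE; apply: (@le_trans _ _ ((D + 1) * `|v|)); last first.
  rewrite -mulrA ler_wpM2l ?addr_ge0//.
  by rewrite ler_pdivlMl.
apply: (@le_trans _ _ (D * `|v|)); last by rewrite ler_wpM2r// lerDl.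
rewrite normrM ger0_norm ?invr_ge0 ?exprn_ge0 ?(ltW S0)// ler_pdivrMl ?exprn_gt0//.
apply: (@le_trans _ _ (2 * (adim A)%:R * (`|p : vec| * `|u|))).
  apply: le_trans (ler_norm_sum _ _ _) _.
  apply: (@le_trans _ _ (\sum_(j < adim A) 2 * (`|p : vec| * `|u|))).
    apply: ler_sum => j _; rewrite !normrM ger0_norm// -mulrA ler_wpM2l//.
    by apply: ler_pM => //; exact: coord_norm.
  by rewrite sumr_const card_ord -mulr_natr le_eqVlt; apply/orP; left; apply/eqP; ring.
apply: (@le_trans _ _ (2 * (adim A)%:R * ((1 + C) * (1 + sqnorm (p : vec)) * `|v|))).
  rewrite ler_wpM2l ?mulr_ge0//; apply: (le_trans (ler_wpM2l _ uv)) => //.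
  by rewrite mulrA ler_wpM2r.
set s1 := 1 + sqnorm _ in S0 S1 *.
rewrite [leLHS](_ : _ = D * `|v| * s1); last by rewrite /D; ring.
rewrite [leRHS](_ : _ = D * `|v| * s1 * s1); last by ring.
apply: ler_peMr => //; apply: mulr_ge0; last exact: ltW.
exact: mulr_ge0.
Qed.


End Metric.

(** * A lower bound for the Riemannian distance *)

Section DistanceLower.
Variables (R : realType) (A : nilalg R).
Local Notation vec := 'rV[R]_(adim A).
Local Notation G := (nilpotent_lie A).
Variable g : G -> 'M[R]_(adim A).
Hypothesis gR : riemannian_metric g.
Hypothesis gL : left_invariant_metric g.

(** It equals 1 at the identity and is globally Lipschitz for every
    left-invariant metric; this avoids any discussion of paths that leave a
    compact set. *)
Definition depth (x : vec) : R := (1 + sqnorm x)^-1.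

Section Curve.
Variable gamma : R -> G.
Hypothesis gC1 : C1_curve gamma.

Let gam : R -> vec := gamma.
Let dgam : R -> vec := derive1 gam.

Let cgam (t : R) : 0 <= t <= 1 -> {for t, continuous gam}.
Proof. by move=> /gC1[]. Qed.

Let Dgam (t : R) : 0 <= t <= 1 -> derivable gam t 1.
Proof.
move=> t01; have [_ h] := gC1 t01.
have hn : nbhs t (fun s => derivable gam s 1) by exact: (h 1%g I).1.
exact: (@nbhs_singleton R t _ hn).
Qed.

Let cdgam (t : R) : 0 <= t <= 1 -> {for t, continuous dgam}.
Proof. by move=> t01; have [_ h] := gC1 t01; exact: (h 1%g I).2. Qed.

Let cgamj j (t : R) : 0 <= t <= 1 -> {for t, continuous (fun s => gam s 0 j)}.
Proof.
move=> t01; exact: (continuous_comp (cgam t01) (@coord_continuous _ _ _ _ _ _)).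
Qed.

Let cdgamj j (t : R) : 0 <= t <= 1 -> {for t, continuous (fun s => dgam s 0 j)}.
Proof.
move=> t01; exact: (continuous_comp (cdgam t01) (@coord_continuous _ _ _ _ _ _)).
Qed.

Let Dgamj j (t : R) : 0 <= t <= 1 -> is_derive t 1 (fun s => gam s 0 j) (dgam t 0 j).
Proof.
move=> /Dgam Dt; split; first exact: ((derivable_mxP gam t 1).1 Dt 0 j).
by rewrite /dgam derive1E derive_mx// mxE.
Qed.

Let sgam (t : R) := 1 + sqnorm (gam t).

Let sgam_gt0 (t : R) : 0 < sgam t.
Proof. by rewrite /sgam ltr_pwDl// sqnorm_ge0. Qed.

Let Dsgam (t : R) : 0 <= t <= 1 ->
  is_derive t 1 sgam (\sum_j 2 * gam t 0 j * dgam t 0 j).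
Proof.
move=> t01.
have sE : sgam = cst 1 + \sum_j (fun s => gam s 0 j) ^+ 2.
  apply/funext => s; rewrite /sgam /sqnorm; congr (_ + _).
  by rewrite fct_sumE; apply: eq_bigr => j _; rewrite !expr2.
rewrite sE; apply: is_derive_eq.
  apply: is_deriveD; apply: is_derive_sum => j.
  by apply: is_deriveX; exact: Dgamj.
rewrite add0r; apply: eq_bigr => j _.
by rewrite expr1.
Qed.

Let csgam (t : R) : 0 <= t <= 1 -> {for t, continuous sgam}.
Proof.
move=> /Dsgam[h _]; apply: differentiable_continuous.
exact/derivable1_diffP.
Qed.

Let F (t : R) := (sgam t)^-1.

Let f (t : R) := - ((sgam t) ^- 2 * \sum_j 2 * gam t 0 j * dgam t 0 j).

Let DF (t : R) : 0 <= t <= 1 -> is_derive t 1 F (f t).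
Proof.
move=> /Dsgam[h1 h2]; split.
  by apply: derivableV => //; rewrite gt_eqF.
by rewrite deriveV// ?gt_eqF// h2 /f scaleNr.
Qed.

Let cF (t : R) : 0 <= t <= 1 -> {for t, continuous F}.
Proof.
move=> /DF[h _]; apply: differentiable_continuous.
exact/derivable1_diffP.
Qed.

Let continuous_sum_at (I : Type) (r : seq I) (h : I -> R -> R) (t : R) :
  (forall i, {for t, continuous (h i)}) ->
  {for t, continuous (fun s => \sum_(i <- r) h i s)}.
Proof.
move=> ch; elim: r => [|i r ih].
  have -> : (fun s => \sum_(i <- [::]) h i s) = cst 0.
    by apply/funext => s; rewrite big_nil.
  exact: cvg_cst.
have -> : (fun s => \sum_(j <- i :: r) h j s) = h i \+ (fun s => \sum_(j <- r) h j s).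
  by apply/funext => s; rewrite big_cons.
by apply: cvgD; [exact: ch|exact: ih].
Qed.

Let cf (t : R) : 0 <= t <= 1 -> {for t, continuous f}.
Proof.
move=> t01; apply: cvgN; apply: cvgM.
  apply: cvgV; first by rewrite expf_neq0// gt_eqF.
  by apply: cvgM; exact: csgam.
apply: continuous_sum_at => j; apply: cvgM; last exact: cdgamj.
by apply: cvgM; [exact: cvg_cst|exact: cgamj].
Qed.

Let cspeed (t : R) : 0 <= t <= 1 -> {for t, continuous (speed g gamma)}.
Proof.
move=> t01.
have -> : speed g gamma = fun t => Num.sqrt
    (\sum_i \sum_j dgam t 0 j * g (gamma t) j i * dgam t 0 i).
  by apply/funext => s; rewrite /speed innerE.
apply: continuous_comp; last exact: sqrt_continuous.
apply: continuous_sum_at => i; apply: continuous_sum_at => j.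
apply: cvgM; last exact: cdgamj.
apply: cvgM; first exact: cdgamj.
apply: (@continuous_comp _ _ _ gam (fun p : vec => g (p : G) j i)).
  exact: cgam.
exact: continuous_metric_coef.
Qed.

Let within01 (h : R -> R) : (forall t : R, 0 <= t <= 1 -> {for t, continuous h}) ->
  {within `[0, 1], continuous h}.
Proof.
move=> ch; apply: continuous_in_subspaceT => t; rewrite inE/= in_itv/=.
exact: ch.
Qed.

Let measurable01 (h : R -> R) : (forall t : R, 0 <= t <= 1 -> {for t, continuous h}) ->
  measurable_fun (`[0, 1]%classic : set (measurableTypeR R)) h.
Proof.
by move=> /within01; apply: subspace_continuous_measurable_fun.
Qed.

(** The fundamental theorem of calculus along the curve, combined with the bound
    on the differential. *)
Lemma depth_curve K : 0 < K ->
  (forall (p : G) (u : vec),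
    `|(1 + sqnorm (p : vec)) ^- 2 * \sum_j 2 * (p : vec) 0 j * u 0 j|
     <= K * Num.sqrt (inner g p u u)) ->
  (`|depth (gamma 1) - depth (gamma 0)|%:E <= K%:E * curve_length g gamma)%E.
Proof.
move=> K0 hK.
have -> : (`|depth (gamma 1) - depth (gamma 0)|%:E =
    `| \int[@lebesgue_measure R]_(x in `[0%R, 1%R]) (f x)%:E |)%E.
  have -> := @continuous_FTC2 R f F 0 1 ltr01 (within01 cf).
  - by [].
  - split.
    + by move=> t; rewrite in_itv/= => /andP[/ltW t0 /ltW t1];
        case: (@DF t); rewrite ?t0.
    + by apply: cvg_at_right_filter; apply: cF; rewrite lexx ler01.
    + by apply: cvg_at_left_filter; apply: cF; rewrite lexx ler01.
  - move=> t; rewrite in_itv/= => /andP[/ltW t0 /ltW t1].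
    by rewrite derive1E; case: (@DF t); rewrite ?t0.
rewrite (le_trans (le_abse_integral _ _ _))//.
  by apply/measurable_EFinP; exact: measurable01.
rewrite /curve_length -ge0_integralZl_EFin//; last 3 first.
- by move=> t _; rewrite lee_fin sqrtr_ge0.
- by apply/measurable_EFinP; exact: measurable01.
- exact: ltW.
apply: ge0_le_integral => //.
- by apply: measurableT_comp => //; apply/measurable_EFinP; exact: measurable01.
- apply: emeasurable_funM => //; apply/measurable_EFinP; exact: measurable01.
- move=> t /= t01; rewrite -EFinM lee_fin /f normrN.
  exact: hK.
Qed.

End Curve.

Lemma riemannian_dist_ge : exists2 c : R, 0 < c &
  forall x : vec, ((c * (1 - depth x))%R%:E <= riemannian_dist g (x : G) 1%g)%E.
Proof.
have [K K0 hK] := speed_bound gR gL.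
have path_le (s : seq (R -> G)) (x y : G) : piecewise_C1_path x s y ->
    (`|depth (y : vec) - depth (x : vec)|%:E <=
      K%:E * \sum_(c <- s) curve_length g c)%E.
  elim: s x => [x <-|c s ih x [C1 <- /ih h]].
    by rewrite big_nil mule0 subrr normr0.
  rewrite big_cons ge0_muleDr; last 2 first.
  - by apply: integral_ge0 => t _; rewrite lee_fin sqrtr_ge0.
  - by apply: sume_ge0 => l _; apply: integral_ge0 => t _; rewrite lee_fin sqrtr_ge0.
  apply: le_trans (leeD (depth_curve C1 K0 hK) h).
  rewrite -EFinD lee_fin [leRHS]addrC.
  apply: le_trans (ler_normD _ _).
  by rewrite subrKA.
exists K^-1; first by rewrite invr_gt0.
move=> x; apply: le_ereal_inf_tmp => _ [s /path_le xs <-].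
rewrite -(@lee_pmul2l _ K%:E)// -EFinM mulrA mulfV ?gt_eqF// mul1r.
apply: le_trans xs; rewrite lee_fin.
have -> : depth (1%g : G) = 1.
  rewrite /depth (_ : sqnorm _ = 0) ?addr0 ?invr1//.
  by apply: big1 => j _; rewrite lie_1gE mxE expr0n.
exact: ler_norm.
Qed.

End DistanceLower.

(** * Topology and Borel sets of tuples *)

Section TupleTopology.
Variables (R : realType) (A : nilalg R) (K : nat).
Local Notation vec := 'rV[R]_(adim A).
Local Notation G := (nilpotent_lie A).
Local Notation X := (gtuple G K).

(** Convergence in the product topology is convergence of each component. *)
Lemma gtuple_cvg (F : set_system X) (x : X) : Filter F ->
  (forall i, (fun y : X => y i) @ F --> x i) -> F --> x.
Proof.
move=> FF Fx; apply/cvg_sup => i B [_ [[V oV <-] Vx] VB].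
apply: filterS VB _; apply: (Fx i); exact: open_nbhs_nbhs.
Qed.

Lemma proj_gtuple_continuous (i : 'I_K) : continuous (fun y : X => y i : vec).
Proof. exact: (@proj_continuous _ (fun _ : 'I_K => G) i). Qed.

Definition tbox (c : X) (e : R) : set X :=
  [set y | forall i, `|(y i : vec) - c i| <= e].

Lemma open_tbox (U : set X) x : open U -> U x ->
  exists2 e, 0 < e & tbox x e `<=` U.
Proof.
move=> oU Ux.
pose F := filter_from [set e : R | 0 < e] (tbox x).
have FF : Filter F.
  apply: filter_from_filter; first by exists 1 => /=.
  move=> e1 e2 /= e10 e20; exists (Num.min e1 e2); first by rewrite /= lt_min e10.
  by move=> y yx; split=> i; rewrite (le_trans (yx i))// ge_min lexx ?orbT.
have Fx : F --> x.
  apply: gtuple_cvg => i; apply/(@cvgrPdist_le R vec) => e e0.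
  by exists e => // y yx /=; rewrite distrC.
have : F U by apply: Fx; exact: open_nbhs_nbhs.
by case=> e /= e0 eU; exists e.
Qed.

Lemma tbox_compact c e : compact (tbox c e).
Proof.
have cb (v : vec) : compact [set u : vec | `|u - v| <= e].
  apply: bounded_closed_compact.
    exists (e + `|v|); split; first exact: num_real.
    move=> M Mev u /= uv; rewrite (le_trans _ (ltW Mev))//.
    by rewrite -{1}(subrK v u) (le_trans (ler_normD _ _))// lerD2r.
  rewrite (_ : [set _ | _] = (fun u : vec => `|u - v|) @^-1` [set t : R | t <= e])//.
  apply: closed_comp; last exact: closed_le.
  move=> u _; apply: (@continuous_comp _ _ _ (fun w : vec => w - v) (fun w : vec => `|w|)).
    apply: polynomial_row_continuous; apply: polynomial_rowD.
      by apply: polynomial_row_linear => // w; exact: cvg_id.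
    by move=> j; exact: polynomial_cst.
  exact: norm_continuous.
exact: (@tychonoff _ (fun _ : 'I_K => G)
   (fun i => [set u : vec | `|u - (c i : vec)| <= e])).
Qed.

Lemma tbox_closed c e : closed (tbox c e).
Proof.
apply: compact_closed; last exact: tbox_compact.
exact: (@hausdorff_product _ (fun _ : 'I_K => G) (fun=> lie_hausdorff)).
Qed.

Lemma compact_tbox (C : set X) : compact C ->
  exists M, C `<=` tbox (fun=> 1%g) M.
Proof.
move=> cC.
have bnd (i : 'I_K) : exists M : R, forall y, C y -> `|(y i : vec)| <= M.
  have : compact ((fun y : X => y i : vec) @` C).
    apply: continuous_compact => //; apply: continuous_subspaceT.
    exact: proj_gtuple_continuous.
  move=> /compact_bounded[M [_ hM]]; exists (M + 1) => y Cy.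
  by apply: hM; [rewrite ltrDl|exists y].
have [M hM] := choice bnd; exists (\sum_i `|M i|) => y Cy i.
rewrite /= lie_1gE subr0 (le_trans (hM i y Cy))// (le_trans (ler_norm _))//.
by rewrite (bigD1 i)//= lerDl sumr_ge0.
Qed.

Local Notation mX := (g_sigma_algebraType (@open X)).
Local Notation J := ('I_K * 'I_(adim A))%type.

Definition gcoord (x : X) (p : J) : R := (x p.1 : vec) 0 p.2.

Definition of_gcoord (f : J -> R) : X := fun i => (\row_j f (i, j) : vec).

Lemma gcoord_of_gcoord f p : gcoord (of_gcoord f) p = f p.
Proof. by case: p => i j; rewrite /gcoord /of_gcoord mxE. Qed.

Lemma of_gcoord_coord x : of_gcoord (gcoord x) = x.
Proof. by apply/funext => i; apply/rowP => j; rewrite mxE. Qed.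

Lemma coord_inj x y : gcoord x =1 gcoord y -> x = y.
Proof. by move=> /funext xy; rewrite -[x]of_gcoord_coord xy of_gcoord_coord. Qed.

Lemma tbox_coord c e x : 0 <= e ->
  tbox c e x <-> forall p, `|gcoord x p - gcoord c p| <= e.
Proof.
move=> e0; split=> [xe [i j]|xe i].
  by have /(row_norm_le _ e0)/(_ j) := xe i; rewrite !mxE.
by apply/row_norm_le => // j; rewrite !mxE; exact: (xe (i, j)).
Qed.

Lemma coord_continuous_gtuple p : continuous (gcoord ^~ p).
Proof.
move=> x; apply: (@continuous_comp _ _ _ (fun y : X => y p.1 : vec)
  (fun v : vec => v 0 p.2)); first exact: proj_gtuple_continuous.
exact: coord_continuous.
Qed.

Lemma continuous_measurable_gtuple (f : X -> R) :
  continuous f -> measurable_fun [set: mX] (f : mX -> R).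
Proof.
move=> cf; apply: (measurability _ (RGenOpens.measurableE R)) => _ [_ [a [b ->] <-]].
rewrite setTI; apply: sub_sigma_algebra.
by have /continuousP := cf; apply; exact: interval_open.
Qed.

Lemma measurable_coord p : measurable_fun [set: mX] (gcoord ^~ p : mX -> R).
Proof.
by apply: continuous_measurable_gtuple; exact: coord_continuous_gtuple.
Qed.

(** Open sets are countable unions of boxes with rational centres and radii. *)
Lemma measurable_gtuple d (T : measurableType d) (f : T -> mX) :
  (forall p, measurable_fun setT (fun t => gcoord (f t) p)) ->
  measurable_fun setT f.
Proof.
move=> mf; apply: (@measurability _ _ T mX setT f (@open X) erefl) => _ [U oU <-]; rewrite setTI.
pose B (qr : {ffun J -> rat} * rat) : set X :=
  tbox (of_gcoord (fun p => ratr (qr.1 p))) (ratr qr.2).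
pose D := [set qr : {ffun J -> rat} * rat | 0 <= ratr qr.2 :> R /\ B qr `<=` U].
have -> : f @^-1` U = \bigcup_(qr in D) (f @^-1` B qr).
  apply/seteqP; split=> [t /= Uft|t [qr [_ BU] Bt]]; last exact: BU.
  have [e e0 eU] := open_tbox oU Uft.
  have /rat_in_itvoo[r] : 0 < e / 2 by rewrite divr_gt0.
  rewrite in_itv/= => /andP[r0 re].
  have qx p : exists q : rat, `|gcoord (f t) p - ratr q| < ratr r.
    have /rat_in_itvoo[q] : gcoord (f t) p - ratr r < gcoord (f t) p + ratr r.
      by rewrite ltrD2l gtrN.
    by rewrite in_itv/= => qr; exists q; rewrite distrC ltr_distl.
  have [q hq] := choice qx.
  exists ([ffun p => q p], r); last first.
    apply/tbox_coord; first exact: ltW.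
    by move=> p; rewrite gcoord_of_gcoord/= ffunE ltW.
  split; first exact: ltW.
  move=> y /(tbox_coord _ _ (ltW r0)) yq; apply: eU; apply/tbox_coord.
    exact: ltW.
  move=> p; have := yq p; rewrite gcoord_of_gcoord/= ffunE => ypq.
  rewrite -(subrKA (ratr (q p))) (le_trans (ler_normD _ _))//.
  rewrite (splitr e) lerD//; first exact: le_trans ypq (ltW re).
  by rewrite distrC; apply: ltW; apply: lt_trans re; exact: hq.
rewrite bigcup_mkcond; apply: countable_bigcupT_measurable => [|qr].
  exact: countableP.
case: ifPn => [|_]; last exact: measurable0.
rewrite inE => -[r0 _].
have -> : f @^-1` B qr = \bigcap_(p in [set: J])
    ((fun t => gcoord (f t) p) @^-1` `[ratr (qr.1 p) - ratr qr.2, ratr (qr.1 p) + ratr qr.2]).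
  apply/seteqP; split=> t.
    move=> /(tbox_coord _ _ r0) h p _; have := h p.
    by rewrite gcoord_of_gcoord/= in_itv/= ler_distl.
  move=> h; apply/tbox_coord => // p; have := h p I.
  by rewrite gcoord_of_gcoord/= in_itv/= ler_distl.
apply: fin_bigcap_measurable; first exact: finite_finset.
move=> p _; rewrite -[X in measurable X]setTI.
apply: mf => //; exact: measurable_itv.
Qed.

End TupleTopology.
Arguments gcoord {R A K} x p.

(** * Haar measure by iterated integration *)

(** The image of Lebesgue measure under a translation agrees with it on
    intervals. *)
Lemma ge0_integral_translation (R : realType) (h : R -> \bar R) (a : R) :
  measurable_fun [set: R] h -> (forall r, 0 <= h r)%E ->
  (\int[@lebesgue_measure R]_r h (r + a)%R = \int[@lebesgue_measure R]_r h r)%E.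
Proof.
move=> mh h0.
pose shift_a (r : measurableTypeR R) : measurableTypeR R := r + a.
have ms : measurable_fun setT shift_a by exact: measurable_funD.
pose nu := pushforward (@lebesgue_measure R) shift_a.
have nuE B : measurable B -> nu B = (@lebesgue_measure R) B.
  move=> mB; apply/esym; apply: (lebesgue_measure_unique (mu := nu)) => //.
  move=> _ [[x y] _ <-].
  transitivity ((@lebesgue_measure R) (`]x - a, y - a]%classic : set R)).
    rewrite !lebesgue_measure_itv/= !lte_fin ltrD2r; case: ifPn => // _.
    by rewrite -!EFinB; congr EFin; ring.
  congr (lebesgue_measure _).
  by apply/seteqP; split=> r /=; rewrite !in_itv/= /shift_a ltrBlDr lerBrDr.
have := @ge0_integral_pushforward _ _ _ _ R _ ms (@lebesgue_measure R) setT h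
  measurableT mh (fun r _ => h0 r).
rewrite preimage_setT => <-.
by apply: eq_measure_integral => B mB _; exact: nuE.
Qed.

Section IteratedIntegral.
Variables (R : realType) (A : nilalg R) (K : nat).
Local Notation vec := 'rV[R]_(adim A).
Local Notation G := (nilpotent_lie A).
Local Notation X := (gtuple G K).
Local Notation mX := (g_sigma_algebraType (@open X)).
Local Notation J := ('I_K * 'I_(adim A))%type.
Implicit Types (h : mX -> \bar R) (x y : X) (p q : J) (l : seq J).

Definition upd x p (r : R) : X :=
  of_gcoord (fun q => if q == p then r else gcoord x q).

Lemma coord_upd x p r q : gcoord (upd x p r) q = if q == p then r else gcoord x q.
Proof. exact: gcoord_of_gcoord. Qed.

Lemma measurable_upd p :
  measurable_fun setT (fun xr : mX * R => upd xr.1 p xr.2 : mX).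
Proof.
apply: measurable_gtuple => q; have [->|qp] := eqVneq q p.
  rewrite (_ : (fun _ => _) = snd); first exact: measurable_snd.
  by apply/funext => xr; rewrite coord_upd eqxx.
rewrite (_ : (fun _ => _) = (gcoord ^~ q : mX -> R) \o fst).
  by apply: measurableT_comp; [exact: measurable_coord|exact: measurable_fst].
by apply/funext => xr; rewrite coord_upd (negbTE qp).
Qed.

Lemma measurable_upd_r x p : measurable_fun setT (upd x p : R -> mX).
Proof.
apply: measurable_gtuple => q.
have [->|qp] := eqVneq q p.
  rewrite (_ : (fun _ => _) = id); first exact: measurable_id.
  by apply/funext => r; rewrite coord_upd eqxx.
rewrite (_ : (fun _ => _) = cst (gcoord x q)); first exact: measurable_cst.
by apply/funext => r; rewrite coord_upd (negbTE qp).
Qed.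

(** Integration of [h] in the coordinate [p], the others being kept fixed; the
    result is a function constant in the coordinate [p]. *)
Definition int1 p h : mX -> \bar R :=
  fun x => (\int[@lebesgue_measure R]_r h (upd x p r))%E.

Definition iint l h : mX -> \bar R := foldr int1 h l.

Definition nneg_measurable h :=
  measurable_fun setT h /\ (forall x, 0 <= h x)%E.

Lemma nneg_measurable_upd h x p : nneg_measurable h ->
  measurable_fun setT (fun r : R => h (upd x p r)).
Proof.
by move=> [mh _]; apply: (measurableT_comp mh); exact: measurable_upd_r.
Qed.

Lemma int1_nneg_measurable p h : nneg_measurable h -> nneg_measurable (int1 p h).
Proof.
move=> [mh h0]; split; last by move=> x; apply: integral_ge0.
apply: (@measurable_fun_fubini_tonelli_F _ _ _ _ R (@lebesgue_measure R)
  (fun xr : mX * R => h (upd xr.1 p xr.2))) => //.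
by apply: (measurableT_comp mh); exact: measurable_upd.
Qed.

Lemma iint_nneg_measurable l h : nneg_measurable h -> nneg_measurable (iint l h).
Proof. by move=> nh; elim: l => [//|p l ih] /=; exact: int1_nneg_measurable. Qed.

Lemma iint0 l : iint l (cst 0%E) = cst 0%E.
Proof.
elim: l => [//|p l ih] /=; rewrite ih; apply/funext => x.
by rewrite /int1 integral0.
Qed.

Lemma iint_nneseries l (h : nat -> mX -> \bar R) :
  (forall n, nneg_measurable (h n)) ->
  iint l (fun x => (\sum_(n <oo) h n x)%E) = fun x => (\sum_(n <oo) iint l (h n) x)%E.
Proof.
move=> nh; elim: l => [//|p l ih] /=; rewrite ih; apply/funext => x.
rewrite /int1 integral_nneseries//.
- by move=> n; apply: nneg_measurable_upd; exact: iint_nneg_measurable.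
- by move=> n r _; exact: (iint_nneg_measurable l (nh n)).2.
Qed.

Lemma iint_ext l h x y :
  (forall q, q \notin l -> gcoord x q = gcoord y q) -> iint l h x = iint l h y.
Proof.
elim: l x y => [|p l ih] x y xy /=.
  by congr h; apply: coord_inj => q; exact: xy.
apply: eq_integral => r _; apply: ih => q ql; rewrite !coord_upd.
by have [//|qp] := eqVneq q p; apply: xy; rewrite inE negb_or qp.
Qed.

(** A box is a product of intervals; this computes Haar measure on boxes, which
    gives both finiteness on compact sets and positivity on open sets. *)
Lemma iint_tbox (c : X) (e : R) l x : 0 <= e -> uniq l ->
  iint l (EFin \o \1_(tbox c e)) x =
  ((2 * e) ^+ size l *
    ([forall q, (q \notin l) ==> (`|gcoord x q - gcoord c q| <= e)] : bool)%:R)%:E.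
Proof.
move=> e0; elim: l x => [|p l ih] x /=.
  move=> _; rewrite expr0 mul1r indicE; congr ((nat_of_bool _)%:R%:E); apply/idP/idP.
    by rewrite inE => /(tbox_coord _ _ e0) xe; apply/forallP.
  move=> /forallP xe; rewrite inE; exact/tbox_coord.
move=> /andP[pl ul]; rewrite /int1.
set b := [forall q, _] : bool.
have indE : (fun r : R => ((r \in `[gcoord c p - e, gcoord c p + e])%:R : R)%:E) =
    EFin \o \1_(`[gcoord c p - e, gcoord c p + e]%classic : set R).
  by apply/funext => r; rewrite /= indicE mem_setE.
under eq_integral => r _.
  rewrite (ih _ ul).
  rewrite (_ : [forall q, _] = b && (r \in `[gcoord c p - e, gcoord c p + e])); last first.
    rewrite in_itv/= -ler_distl; apply/forallP/andP => [h|[/forallP h hr] q].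
      split; last by have := h p; rewrite pl coord_upd eqxx.
      apply/forallP => q; apply/implyP; rewrite inE negb_or => /andP[qp ql].
      by have := h q; rewrite ql coord_upd (negbTE qp).
    apply/implyP => ql; rewrite coord_upd; have [->//|qp] := eqVneq q p.
    by have := h q; rewrite inE negb_or qp ql.
  rewrite -mulnb natrM mulrA EFinM.
  over.
rewrite /= ge0_integralZl_EFin//=; last 2 first.
- by rewrite indE; apply/measurable_EFinP; exact: measurable_indic.
- by rewrite mulr_ge0// exprn_ge0// mulr_ge0.
rewrite indE.
rewrite integral_indic//= setIT lebesgue_measure_itv/= lte_fin.
case: ifPn => [_|]; first by rewrite -EFinB -EFinM exprS; congr EFin; ring.
rewrite -leNgt => h; have -> : e = 0 by lra.
by rewrite mule0 mulr0 exprS mul0r mul0r.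
Qed.

End IteratedIntegral.

Section Haar.
Variables (R : realType) (A : nilalg R) (K : nat).
Local Notation vec := 'rV[R]_(adim A).
Local Notation G := (nilpotent_lie A).
Local Notation X := (gtuple G K).
Local Notation mX := (g_sigma_algebraType (@open X)).
Local Notation J := ('I_K * 'I_(adim A))%type.
Implicit Types (h : mX -> \bar R) (x y : X) (p q : J) (l : seq J).

Definition gdeg (p : J) : nat := adeg p.2.

Definition ltrans (a x : X) : X := fun i => (a i * x i)%g.

(** Left translation is triangular: it adds to each coordinate a function of the
    coordinates of smaller degree. *)
Lemma gcoord_ltrans a x y p :
  (forall q, (gdeg q < gdeg p)%N -> gcoord x q = gcoord y q) ->
  gcoord (ltrans a x) p - gcoord x p = gcoord (ltrans a y) p - gcoord y p.
Proof.
case: p => i j xy; rewrite /gcoord /ltrans !lie_mulgE /=.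
have gE (z : vec) : gmul (a i : vec) z 0 j - z 0 j =
    (a i : vec) 0 j + amul (a i : vec) z 0 j.
  by rewrite /gmul; move: (amul _ _) => m; rewrite 2!mxE; ring.
rewrite !gE; congr (_ + _).
rewrite !mxE; apply: eq_bigr => u _; apply: eq_bigr => v _.
have [->|c0] := eqVneq (acst j u v) 0; first by rewrite !mul0r.
congr (_ * (_ * _)); apply: (xy (i, v)).
rewrite /gdeg /= (leq_trans _ (acst_deg c0))// -[X in (X < _)%N]add0n.
by rewrite ltn_add2r adeg_gt0.
Qed.

(** With the coordinates of highest degree integrated first, a left translation
    acts on the current coordinate by a translation of the line, while the inner
    integral does not depend on the coordinates already integrated. *)
Lemma iint_ltrans l h a x : nneg_measurable h ->
  uniq l -> sorted (fun p q => gdeg p <= gdeg q)%N l ->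
  (forall p q, p \in l -> q \notin l -> (gdeg q <= gdeg p)%N) ->
  iint l (h \o ltrans a) x = iint l h (ltrans a x).
Proof.
move=> nh; elim: l x => [//|p l ih] x /= /andP[pl ul] sl ltl.
have tr : transitive (fun p q : J => (gdeg p <= gdeg q)%N).
  by move=> q r s; exact: leq_trans.
have pmin q : q \in l -> (gdeg p <= gdeg q)%N.
  by move: sl; rewrite (path_sortedE tr) => /andP[/allP + _] => /[apply].
have ihl y : iint l (h \o ltrans a) y = iint l h (ltrans a y).
  apply: ih => //; first exact: path_sorted sl.
  move=> q r ql rl; have [->|rp] := eqVneq r p; first exact: pmin.
  by apply: ltl; rewrite inE ?ql ?orbT// negb_or rp.
pose s := gcoord (ltrans a x) p - gcoord x p.
transitivity (\int[@lebesgue_measure R]_r iint l h (upd (ltrans a x) p (r + s)))%E.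
  apply: eq_integral => r _; rewrite ihl; apply: iint_ext => q ql.
  have xq : gcoord (ltrans a (upd x p r)) q - gcoord (upd x p r) q =
            gcoord (ltrans a x) q - gcoord x q.
    apply: gcoord_ltrans => q' q'q; rewrite coord_upd.
    case: eqP => // q'p; exfalso; move: q'q; rewrite q'p ltnNge => /negP; apply.
    have [->//|qp] := eqVneq q p.
    by apply: ltl; rewrite inE ?eqxx// negb_or qp.
  have -> : gcoord (ltrans a (upd x p r)) q =
      gcoord (upd x p r) q + (gcoord (ltrans a x) q - gcoord x q).
    by rewrite -xq; ring.
  rewrite !coord_upd; have [->//|qp] := eqVneq q p.
  by ring.
rewrite (ge0_integral_translation (h := fun r => iint l h (upd (ltrans a x) p r)) s)//.
  by apply: nneg_measurable_upd; exact: iint_nneg_measurable.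
by move=> r; exact: (iint_nneg_measurable l nh).2.
Qed.

Definition coord_order : seq J := sort (fun p q => gdeg p <= gdeg q)%N (enum {: J}).

Lemma mem_coord_order p : p \in coord_order.
Proof. by rewrite mem_sort mem_enum. Qed.

Lemma uniq_coord_order : uniq coord_order.
Proof. by rewrite sort_uniq enum_uniq. Qed.

Lemma sorted_coord_order : sorted (fun p q => gdeg p <= gdeg q)%N coord_order.
Proof. by apply: sort_sorted => p q; exact: leq_total. Qed.

Definition haar (B : set mX) : \bar R :=
  iint coord_order (EFin \o \1_B) (of_gcoord (fun=> 0)).

Lemma haarE (B : set mX) x : haar B = iint coord_order (EFin \o \1_B) x.
Proof. by apply: iint_ext => q; rewrite mem_coord_order. Qed.

Lemma nneg_measurable_indic (B : set mX) :
  measurable B -> nneg_measurable (EFin \o \1_B : mX -> \bar R).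
Proof.
move=> mB; split; last by move=> x; rewrite lee_fin.
by apply/measurable_EFinP; exact: measurable_indic.
Qed.

Let haar0 : haar set0 = 0%E.
Proof.
rewrite /haar (_ : _ \o _ = cst 0%E) ?iint0//.
by apply/funext => x; rewrite /= indic0.
Qed.

Let haar_ge0 B : (0 <= haar B)%E.
Proof.
rewrite /haar; move: (of_gcoord _); elim: coord_order => [x|p l ih x] /=.
  by rewrite lee_fin.
by apply: integral_ge0.
Qed.

Let haar_sigma : semi_sigma_additive haar.
Proof.
move=> F mF tF mUF.
have -> : haar (\bigcup_n F n) = (\sum_(n <oo) haar (F n))%E.
  rewrite /haar (_ : EFin \o \1_(\bigcup_n F n) =
      fun x => (\sum_(n <oo) (EFin \o \1_(F n)) x)%E); last first.
    by apply/funext => x; rewrite /= indic_bigcup.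
  by rewrite iint_nneseries// => n; exact: nneg_measurable_indic.
by apply: is_cvg_ereal_nneg_natsum => n _; exact: haar_ge0.
Qed.

HB.instance Definition _ := isMeasure.Build _ _ R haar haar0 haar_ge0 haar_sigma.

Lemma haar_tbox c e : 0 <= e -> haar (tbox c e) = ((2 * e) ^+ size coord_order)%:E.
Proof.
move=> e0; rewrite /haar iint_tbox//; last exact: uniq_coord_order.
rewrite (_ : [forall q, _]) ?mulr1//.
by apply/forallP => q; rewrite mem_coord_order.
Qed.

Lemma measurable_tbox c e : measurable (tbox c e : set mX).
Proof.
rewrite -[X in measurable X]setCK; apply: measurableC.
by apply: sub_sigma_algebra; apply: closed_openC; exact: tbox_closed.
Qed.

Lemma haar_haar_measure : haar_measure haar.
Proof.
split.
- move=> a B mB.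
  pose a' : X := fun i => (a i)^-1%g.
  transitivity (iint coord_order ((EFin \o \1_B) \o ltrans a') (of_gcoord (fun=> 0))).
    rewrite /= /haar; congr (iint _ _ _); apply/funext => x /=.
    rewrite !indicE; congr ((nat_of_bool _)%:R%:E).
    apply/idP/idP; rewrite !inE.
      move=> [y By <-]; rewrite /ltrans/a' (_ : (fun i => _) = y)//.
      by apply/funext => i; rewrite mulKg.
    move=> Bx; exists (ltrans a' x) => //.
    by apply/funext => i; rewrite /ltrans /a' mulVKg.
  rewrite iint_ltrans -?haarE//.
  + exact: nneg_measurable_indic.
  + exact: uniq_coord_order.
  + exact: sorted_coord_order.
  + by move=> p q _; rewrite mem_coord_order.
- move=> C cC; have [M CM] := compact_tbox cC.
  have mC : measurable (C : set mX).
    rewrite -[X in measurable X]setCK; apply: measurableC; apply: sub_sigma_algebra.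
    apply: closed_openC; apply: compact_closed => //.
    exact: (@hausdorff_product _ (fun _ : 'I_K => G) (fun=> lie_hausdorff)).
  have CM' : C `<=` tbox (fun=> 1%g) `|M|.
    by move=> x /CM h i; rewrite (le_trans (h i))// ler_norm.
  apply: (@le_lt_trans _ _ (haar (tbox (fun=> 1%g) `|M|))).
    by apply: le_measure; rewrite ?inE//; exact: measurable_tbox.
  by rewrite haar_tbox// ltry.
- move=> U oU [x Ux]; have [e e0 eU] := open_tbox oU Ux.
  have mU : measurable (U : set mX) by exact: sub_sigma_algebra.
  apply: (@lt_le_trans _ _ (haar (tbox x e))).
    by rewrite haar_tbox ?ltW// lte_fin exprn_gt0// mulr_gt0.
  by apply: le_measure; rewrite ?inE//; exact: measurable_tbox.
Qed.

End Haar.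

(** * Null sets of an arbitrary Haar measure *)

(** The number of roots among the first terms of the sequence is bounded by the
    degree, hence stabilizes. *)
Lemma finitely_many_roots (R : idomainType) (p : {poly R}) (t : nat -> R) :
  p != 0 -> injective t -> exists N, forall n, (N <= n)%N -> ~~ root p (t n).
Proof.
move=> p0 tinj; pose c M := count (fun n => root p (t n)) (iota 0 M).
have cp M : (c M < size p)%N.
  rewrite /c -size_filter -(size_map t); apply: max_poly_roots => //.
    by apply/allP => _ /mapP[n + ->]; rewrite mem_filter => /andP[].
  by rewrite map_inj_uniq// filter_uniq// iota_uniq.
pose P m := `[< exists M, c M = m >].
have exP : exists m, P m by exists (c 0%N); apply/asboolP; exists 0%N.
have leP m : P m -> (m <= size p)%N.
  by move=> /asboolP[M <-]; exact/ltnW/cp.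
have [m /asboolP[M cM] maxm] := ex_maxnP exP leP.
exists M => n Mn; apply/negP => rn.
have : (c n.+1 <= c M)%N by rewrite cM; apply: maxm; apply/asboolP; exists n.+1.
rewrite /c -(subnKC Mn) -addn1 !iotaD !count_cat /= add0n subnKC// rn.
by rewrite addn0 -addnA -[leqRHS]addn0 leq_add2l addn1.
Qed.

Section ContinuousDeterminant.
Variables (R : realType) (T : topologicalType).

Lemma continuous_bigsum (I : Type) (r : seq I) (F : I -> T -> R) :
  (forall i, continuous (F i)) -> continuous (fun x => \sum_(i <- r) F i x).
Proof.
move=> cF; elim: r => [|i r ih].
  have -> : (fun x : T => \sum_(i <- [::]) F i x) = cst 0.
    by apply/funext => y; rewrite big_nil.
  exact: cst_continuous.
have -> : (fun x : T => \sum_(j <- i :: r) F j x) =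
    (fun x => F i x + \sum_(j <- r) F j x).
  by apply/funext => y; rewrite big_cons.
by move=> x; apply: cvgD; [exact: cF|exact: ih].
Qed.

Lemma continuous_bigprod (I : Type) (r : seq I) (F : I -> T -> R) :
  (forall i, continuous (F i)) -> continuous (fun x => \prod_(i <- r) F i x).
Proof.
move=> cF; elim: r => [|i r ih].
  have -> : (fun x : T => \prod_(i <- [::]) F i x) = cst 1.
    by apply/funext => y; rewrite big_nil.
  exact: cst_continuous.
have -> : (fun x : T => \prod_(j <- i :: r) F j x) =
    (fun x => F i x * \prod_(j <- r) F j x).
  by apply/funext => y; rewrite big_cons.
by move=> x; apply: cvgM; [exact: cF|exact: ih].
Qed.

Lemma det_continuous K (M : T -> 'M[R]_K) :
  (forall i j, continuous (fun x => M x i j)) -> continuous (fun x => \det (M x)).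
Proof.
move=> cM; apply: continuous_bigsum => s x; apply: cvgM; first exact: cvg_cst.
by apply: continuous_bigprod => i; exact: cM.
Qed.

End ContinuousDeterminant.

Section NullSets.
Variables (R : realType) (A : nilalg R) (K : nat).
Local Notation vec := 'rV[R]_(adim A).
Local Notation G := (nilpotent_lie A).
Local Notation X := (gtuple G K).
Local Notation mX := (g_sigma_algebraType (@open X)).

Lemma continuous_gmul (a : vec) : continuous (gmul a).
Proof.
apply: polynomial_row_continuous.
have pid : polynomial_row (fun x : vec => x).
  by apply: polynomial_row_linear => // x; exact: cvg_id.
have pc : polynomial_row (fun _ : vec => a) by move=> j; exact: polynomial_cst.
by apply: polynomial_rowD; [exact: polynomial_rowD|exact: polynomial_amul].
Qed.

Lemma measurable_ltrans (a : X) : measurable_fun setT (ltrans a : mX -> mX).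
Proof.
apply: measurable_gtuple => p; apply: continuous_measurable_gtuple => x.
apply: (@continuous_comp _ _ _ (fun y : X => y p.1 : vec)
  (fun v : vec => gmul (a p.1 : vec) v 0 p.2)); first exact: proj_gtuple_continuous.
apply: (@continuous_comp _ _ _ (gmul (a p.1 : vec)) (fun v : vec => v 0 p.2)).
  exact: continuous_gmul.
exact: coord_continuous.
Qed.

Lemma ltrans_tbox (M : R) : 0 <= M -> exists M', forall a x : X,
  tbox (fun=> 1%g) 1 a -> tbox (fun=> 1%g) M x -> tbox (fun=> 1%g) M' (ltrans a x).
Proof.
move=> M0; have [C C0 hC] := amul_bound A.
exists (1 + M + C * (1 * M)) => a x a1 xM i.
have := a1 i; have := xM i; rewrite /= !lie_1gE !subr0 => xiM ai1.
rewrite (le_trans (ler_normD _ _))// lerD//.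
  by rewrite (le_trans (ler_normD _ _))// lerD.
apply: le_trans (hC _ _) _.
by apply: ler_wpM2l; [exact: ltW|exact: ler_pM].
Qed.

Variable mu : {measure set mX -> \bar R}.
Hypothesis mu_haar : haar_measure mu.

(** The translates of a bounded part of [B] all have the same measure and lie in
    a fixed compact set, while no point belongs to infinitely many of them.  If
    this measure were positive, the limsup of the translates, which is empty,
    would have positive measure. *)
Lemma haar_translates_null (B : set mX) (a : nat -> X) : measurable B ->
  (forall n, tbox (fun=> 1%g) 1 (a n)) ->
  (forall x, exists N, forall n, (N <= n)%N -> ~ B (ltrans (fun i => (a n i)^-1%g) x)) ->
  mu B = 0%E.
Proof.
move=> mB a1 aB; have [muL muC _] := mu_haar.
pose V M : set mX := tbox (fun=> 1%g) M%:R.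
suff BV M : mu (B `&` V M) = 0%E.
  have -> : B = \bigcup_M (B `&` V M).
    apply/seteqP; split=> [x Bx|x [M _ []]//].
    have [M xM] : exists M : nat, (\sum_i `|(x i : vec)|) <= M%:R.
      exists (Num.bound (\sum_i `|(x i : vec)|)); apply: ltW.
      by apply: archi_boundP; exact: sumr_ge0.
    exists M => //; split=> // i; rewrite lie_1gE subr0 (le_trans _ xM)//.
    by rewrite (bigD1 i)//= lerDl sumr_ge0.
  have mBV M : measurable (B `&` V M).
    by apply: measurableI => //; exact: measurable_tbox.
  have : mu.-negligible (\bigcup_M (B `&` V M)).
    apply: negligible_bigcup => M; apply/negligibleP => //; exact: BV.
  by move/negligibleP; apply; exact: bigcupT_measurable.
have [M' hM'] := ltrans_tbox (ler0n R M).
pose C n : set mX := ltrans (a n) @` (B `&` V M).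
have CE n : C n = ltrans (fun i => (a n i)^-1%g) @^-1` (B `&` V M).
  apply/seteqP; split=> [_ [x Bx <-]|x Bx].
    rewrite /preimage/= (_ : ltrans _ _ = x)//.
    by apply/funext => i; rewrite /ltrans mulKg.
  by exists (ltrans (fun i => (a n i)^-1%g) x) => //; apply/funext => i; rewrite /ltrans mulVKg.
have mBV : measurable (B `&` V M).
  by apply: measurableI => //; exact: measurable_tbox.
have mC n : measurable (C n).
  by rewrite CE -[X in measurable X]setTI; apply: measurable_ltrans.
have muCn n : mu (C n) = mu (B `&` V M) by exact: muL.
(* Tails of the sequence of translates. *)
pose U N : set mX := \bigcup_(n in [set n | (N <= n)%N]) C n.
have mU N : measurable (U N) by apply: bigcup_measurable => n _; exact: mC.
have U0 : (mu (U 0%N) < +oo)%E.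
  apply: (@le_lt_trans _ _ (mu (tbox (fun=> 1%g) M'))); last exact/muC/tbox_compact.
  apply: le_measure; rewrite ?inE//; first exact: measurable_tbox.
  by move=> _ [n _ [x [_ xV] <-]]; apply: hM'.
have UI : \bigcap_N U N = set0.
  apply/seteqP; split=> // x Ux; have [N hN] := aB x.
  have [n Nn] := Ux N I; rewrite CE => -[Bx _].
  exact: (hN n Nn).
have Ucvg : mu \o U @ \oo --> mu (\bigcap_N U N).
  apply: nonincreasing_cvg_mu => //; first by rewrite UI.
  move=> N N' NN'; apply/subsetPset => x [n N'n Cn]; exists n => //.
  exact: leq_trans N'n.
rewrite UI measure0 in Ucvg.
apply/eqP; rewrite eq_le measure_ge0 andbT.
rewrite -(cvg_lim (@ereal_hausdorff R) Ucvg); apply: lime_ge.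
  by apply/cvg_ex; exists 0%E.
apply: nearW => N /=; rewrite -(muCn N); apply: le_measure; rewrite ?inE//.
by move=> x Cx; exists N => /=.
Qed.

Variable e : 'I_K -> 'I_(adim A).
Hypothesis e_inj : injective e.
Hypothesis e_deg : forall i, adeg (e i) = 1%N.

(** [e] selects coordinates of degree one; on these the group law is addition. *)
Definition first_layer (x : X) : 'M[R]_K := \matrix_(i, j) (x i : vec) 0 (e j).

Lemma gmul_deg1 (x y : vec) j : gmul x y 0 (e j) = x 0 (e j) + y 0 (e j).
Proof.
have /(_ (e j)) h := filtM (filt1 x) (filt1 y); rewrite addn1 e_deg in h.
rewrite /gmul; move: (amul _ _) h => m h.
by rewrite 2!mxE h// addr0.
Qed.

Lemma first_layer_ltrans a x : first_layer (ltrans a x) = first_layer a + first_layer x.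
Proof.
have fE (y : X) i j : first_layer y i j = (y i : vec) 0 (e j) by rewrite mxE.
by apply/matrixP => i j; rewrite [RHS]mxE !fE; exact: gmul_deg1.
Qed.

Lemma first_layer_inv x :
  first_layer (fun i => (x i)^-1%g) = - first_layer x.
Proof.
apply/eqP; rewrite -addr_eq0 -first_layer_ltrans.
have -> : ltrans (fun i => (x i)^-1%g) x = (fun=> 1%g).
  by apply/funext => i; rewrite /ltrans mulVg.
by apply/eqP/matrixP => i j; rewrite mxE lie_1gE !mxE.
Qed.

Lemma det_first_layer_continuous : continuous (fun x : X => \det (first_layer x)).
Proof.
apply: det_continuous => i j.
have -> : (fun y : X => first_layer y i j) = gcoord ^~ (i, e j).
  by apply/funext => z; rewrite mxE.
exact: coord_continuous_gtuple.
Qed.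

(** Left translation by a suitable tuple subtracts t I from the first layer X,
    and det (X - t I) vanishes only when t is an eigenvalue of X. *)
Lemma ae_first_layer_unit :
  {ae mu, forall x : X, \det (first_layer x) != 0}.
Proof.
pose B : set mX := (fun x : X => \det (first_layer x)) @^-1` [set 0].
have mB : measurable B.
  rewrite -[B]setTI.
  exact: (continuous_measurable_gtuple det_first_layer_continuous).
exists B; split=> //; last first.
  by move=> x /= /negP; rewrite negbK => /eqP.
pose t (n : nat) : R := n.+1%:R^-1.
have t01 n : 0 <= t n <= 1 by rewrite invr_ge0 ler0n invf_le1// ler1n.
have tinj : injective t.
  by move=> m n /invr_inj/eqP; rewrite eqr_nat eqSS => /eqP.
pose a n : X := fun i => (t n *: delta_mx 0 (e i) : vec).
apply: (@haar_translates_null B a) => //.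
  move=> n i; rewrite lie_1gE subr0; apply/row_norm_le => // j.
  have /andP[t0 t1] := t01 n.
  rewrite !mxE normrM ger0_norm//; case: (_ && _).
    by rewrite normr1 mulr1.
  by rewrite normr0 mulr0.
move=> x.
have aE n : first_layer (a n) = (t n)%:M.
  apply/matrixP => i j; rewrite !mxE eqxx/= (inj_eq e_inj) eq_sym.
  by case: eqP; rewrite ?mulr1// mulr0.
have [N hN] := finitely_many_roots (monic_neq0 (char_poly_monic (first_layer x))) tinj.
exists N => n Nn Bx; have /negP := hN n Nn; apply.
rewrite -eigenvalue_root_char /eigenvalue kermx_eq0 row_free_unit unitmxE unitfE negbK.
by move: Bx; rewrite /B/= first_layer_ltrans first_layer_inv aE addrC => ->.
Qed.

End NullSets.

(** * The truncated free algebra with a one-dimensional top *)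

Section WordAlgebra.
Variables (R : realType) (m : nat) (alpha : R).
Local Notation K := m.+2.
Local Notation s := (m + 7)%N.
Local Notation W := ((m + 6).-bseq 'I_K).
Local Notation word := (seq 'I_K).

(** The letters X ([false]) and Y ([true]) of the critical Lie polynomials. *)
Definition letter (b : bool) : 'I_K := if b then lift ord0 ord0 else ord0.

Definition perm_tail (sigma : 'S_K) : word :=
  [seq sigma (lift ord0 (lift ord0 t)) | t <- enum 'I_m].

(** The words that occur when the products of determinants and minors are
    expanded over permutations.  In the first family the determinant takes the
    factors 1 and 4 (counted from 0) and the last m ones, and the minor takes the
    factors 0 and 6; in the second family they are 1, 5 and 2, 3.  The factors
    left over contribute their first coordinate. *)
Definition word_term (t : 'S_K * bool * bool) : word :=
  let: (sigma, b, first) := t in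
  let s0 := sigma ord0 in let s1 := sigma (lift ord0 ord0) in
  (if first then [:: letter b; s0; ord0; ord0; s1; ord0; letter (~~ b)]
   else [:: ord0; s0; letter b; letter (~~ b); ord0; s1; ord0]) ++ perm_tail sigma.

Definition coef_term (t : 'S_K * bool * bool) : R :=
  let: (sigma, b, first) := t in
  (-1) ^+ sigma * (-1) ^+ b * (if first then 1 else alpha).

Lemma size_word_term t : size (word_term t) = s.
Proof.
case: t => [[sigma b] first]; rewrite size_cat size_map size_enum_ord addnC.
by case: first.
Qed.

Definition top_form (F : word -> R) : R := \sum_t coef_term t * F (word_term t).

(** The coordinate of a word in the algebra.  Basis elements are indexed by words
    of length less than s; the empty word, which has no other use in an algebra
    without unit, indexes the top coordinate. *)
Definition wpair (i : W) (w : word) : R :=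
  if nilp i then top_form (fun u => (w == u)%:R) else (w == i)%:R.

Definition wdeg (i : W) : nat := if nilp i then s else size i.

Definition wcst (i u v : W) : R :=
  (~~ nilp u && ~~ nilp v)%:R * wpair i (u ++ v).

Lemma wpair_size i w : wpair i w != 0 -> size w = wdeg i.
Proof.
rewrite /wpair /wdeg; case: ifPn => _; last first.
  by have [->//|_] := eqVneq w i; rewrite eqxx.
move=> h; apply/eqP; apply: contraNT h => sw.
rewrite /top_form big1// => t _; case: eqP => [wt|_]; last by rewrite mulr0.
by move: sw; rewrite wt size_word_term eqxx.
Qed.

Lemma wdeg_le (i : W) : (wdeg i <= s)%N.
Proof.
rewrite /wdeg; case: ifP => // _; apply: leq_trans (size_bseq i) _.
by rewrite leq_add2l.
Qed.

Lemma wdeg_gt0 (i : W) : (0 < wdeg i)%N.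
Proof.
by rewrite /wdeg; case: ifPn => [_|]; [rewrite addnS|rewrite lt0n].
Qed.

Lemma wdeg_nonnil (i : W) : ~~ nilp i -> wdeg i = size i.
Proof. by rewrite /wdeg => /negbTE ->. Qed.

Lemma wcst_deg i u v : wcst i u v != 0 -> (wdeg u + wdeg v <= wdeg i)%N.
Proof.
rewrite /wcst; have [_|u0] /= := boolP (nilp u); first by rewrite mul0r eqxx.
have [_|v0] /= := boolP (nilp v); first by rewrite mul0r eqxx.
by rewrite mul1r => /wpair_size <-; rewrite size_cat !wdeg_nonnil.
Qed.

Lemma wpair_big i w : (s < size w)%N -> wpair i w = 0.
Proof.
move=> h; apply/eqP; apply/negPn/negP => /wpair_size; have := wdeg_le i; lia.
Qed.

Lemma wpair_sum (F : word -> R) (x : word) : (0 < size x)%N ->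
  ((m + 6 < size x)%N -> F x = 0) ->
  \sum_(j : W) (~~ nilp j)%:R * F j * wpair j x = F x.
Proof.
move=> x0 Fx; have [xs|sx] := leqP (size x) (m + 6).
  pose j0 : W := Bseq xs.
  have j0n : ~~ nilp j0 by rewrite /nilp -lt0n.
  rewrite (bigD1 j0)//= big1 ?addr0 => [|j jj0].
    by rewrite j0n mul1r /wpair (negbTE j0n) eqxx mulr1.
  have [|jn] := boolP (nilp j); first by rewrite !mul0r.
  rewrite /wpair (negbTE jn) (_ : (x == j) = false) ?mulr0//.
  by apply: contraNF jj0 => /eqP xj; apply/eqP/val_inj.
rewrite Fx// big1// => j _.
have [|jn] := boolP (nilp j); first by rewrite !mul0r.
rewrite /wpair (negbTE jn) (_ : (x == j) = false) ?mulr0//.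
by apply/eqP => xj; have := size_bseq j; rewrite -xj leqNgt sx.
Qed.

(** Both sides are the coordinate [i] of the concatenation of the three words. *)
Lemma wcstA i u v w :
  \sum_j wcst i j w * wcst j u v = \sum_j wcst i u j * wcst j v w.
Proof.
rewrite /wcst; have [un|un] /= := boolP (nilp u).
  by rewrite !big1// => j _; rewrite ?mul0r ?mulr0.
have [vn|vn] /= := boolP (nilp v).
  by rewrite !big1// => j _; rewrite ?mul0r ?mulr0.
have [wn|wn] /= := boolP (nilp w).
  by rewrite !big1// => j _; rewrite ?andbF ?mul0r ?mulr0.
have [u0 v0 w0] : [/\ 0 < size u, 0 < size v & 0 < size w]%N by rewrite !lt0n.
transitivity (wpair i ((u ++ v) ++ w)).
  rewrite -(@wpair_sum (fun x => wpair i (x ++ w)))//.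
  - by apply: eq_bigr => j _; rewrite andbT mul1r.
  - by rewrite size_cat addn_gt0 u0.
  - by move=> h; rewrite wpair_big// size_cat; lia.
rewrite -catA -(@wpair_sum (fun x => wpair i (u ++ x)))//.
- by apply: eq_bigr => j _; rewrite mul1r.
- by rewrite size_cat addn_gt0 v0.
- by move=> h; rewrite wpair_big// size_cat; lia.
Qed.

Local Notation n := #|{: W}|.

Definition ecst (i j l : 'I_n) : R := wcst (enum_val i) (enum_val j) (enum_val l).

Lemma ecstA i u v w :
  \sum_j ecst i j w * ecst j u v = \sum_j ecst i u j * ecst j v w.
Proof.
rewrite -(big_enum_val (fun j => wcst (enum_val i) j (enum_val w) *
  wcst j (enum_val u) (enum_val v))).
rewrite -(big_enum_val (fun j => wcst (enum_val i) (enum_val u) j *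
  wcst j (enum_val v) (enum_val w))).
exact: wcstA.
Qed.

Definition word_algebra : nilalg R := @NilAlg R n
  (fun i => wdeg (enum_val i)) s ecst
  (fun i => wdeg_gt0 (enum_val i)) (fun i => wdeg_le (enum_val i))
  (fun i j l => @wcst_deg (enum_val i) (enum_val j) (enum_val l)) ecstA.

Local Notation vec := 'rV[R]_(adim word_algebra).

Definition wcoef (x : vec) (w : word) : R :=
  if insub w is Some w' then x 0 (enum_rank (w' : W)) else 0.

Lemma wcoefE (x : vec) (w : W) : wcoef x w = x 0 (enum_rank w).
Proof. by rewrite /wcoef valK. Qed.

Lemma wcoefD x y w : wcoef (x + y) w = wcoef x w + wcoef y w.
Proof. by rewrite /wcoef; case: insub => [w'|]; rewrite ?mxE ?addr0. Qed.

Lemma wcoefZ a x w : wcoef (a *: x) w = a * wcoef x w.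
Proof. by rewrite /wcoef; case: insub => [w'|]; rewrite ?mxE ?mulr0. Qed.

Lemma wcoef_filt d x (w : word) : filt d x -> (0 < size w < d)%N -> wcoef x w = 0.
Proof.
rewrite /wcoef => fx /andP[w0 wd]; case: insubP => // w' _ w'w.
have sw : size w' = size w by rewrite -w'w.
by apply: fx; rewrite /= enum_rankK wdeg_nonnil ?sw// /nilp sw -lt0n.
Qed.

Lemma wcoef_norm x w : `|wcoef x w| <= `|x|.
Proof.
rewrite /wcoef; case: insub => [w'|]; last by rewrite normr0.
by move: (enum_rank _); apply/row_norm_le.
Qed.

Lemma amul_split (x y : vec) (a : 'I_K) (t : word) : (0 < size t)%N ->
  (size t < s)%N -> filt (size t) y ->
  \sum_(u : W) \sum_(v : W) (~~ nilp u && ~~ nilp v)%:R * (a :: t == u ++ v)%:R *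
    (x 0 (enum_rank u) * y 0 (enum_rank v)) = wcoef x [:: a] * wcoef y t.
Proof.
move=> t0 ts fy.
have at6 : (size [:: a] <= m + 6)%N by rewrite /= addnS.
have tt6 : (size t <= m + 6)%N by rewrite -ltnS -addnS.
pose u0 : W := Bseq at6; pose v0 : W := Bseq tt6.
rewrite (bigD1 u0)//= [X in _ + X]big1 ?addr0 => [|u uu0]; last first.
  apply: big1 => v _; have [|un] /= := boolP (nilp u); first by rewrite !mul0r.
  have [|vn] /= := boolP (nilp v); first by rewrite !mul0r.
  have [atuv|] := eqVneq (a :: t) (u ++ v); last by rewrite mulr0 mul0r.
  rewrite (_ : y 0 (enum_rank v) = 0) ?mulr0//.
  apply: fy; rewrite /= enum_rankK wdeg_nonnil//.
  have /(congr1 size) := atuv; rewrite size_cat /= => e.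
  suff : (1 < size u)%N by lia.
  rewrite ltnNge; apply: contra uu0 => u1; apply/eqP/val_inj => /=.
  move: u1 un atuv; case: (val u) => [//|a' [|//]] _ _ /= [<- _] //.
rewrite (bigD1 v0)//= [X in _ + X]big1 ?addr0 => [|v vv0]; last first.
  have [|vn] /= := boolP (nilp v); first by rewrite !mul0r.
  rewrite eqseq_cons eqxx /= (_ : (t == v) = false) ?mulr0 ?mul0r//.
  by apply: contraNF vv0 => /eqP tv; apply/eqP/val_inj.
rewrite (_ : nilp v0 = false) ?eqxx ?mul1r; last by rewrite /nilp /= eqn0Ngt t0.
by rewrite -(wcoefE x u0) -(wcoefE y v0).
Qed.

Lemma wcoef_amul (x y : vec) (a : 'I_K) (t : word) : (0 < size t)%N ->
  (size t < m + 6)%N -> filt (size t) y ->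
  wcoef (amul x y) (a :: t) = wcoef x [:: a] * wcoef y t.
Proof.
move=> t0 ts fy; have ats : (size (a :: t) <= m + 6)%N by [].
pose w : W := Bseq ats.
rewrite -(amul_split x a t0)//; last by rewrite (ltn_trans ts)// ltn_add2l.
rewrite (wcoefE _ w) mxE.
rewrite [RHS](big_enum_val (fun u : W => \sum_(v : W) _)) /=.
apply: eq_bigr => u _.
rewrite [RHS](big_enum_val (fun v : W => _)) /=.
apply: eq_bigr => v _.
by rewrite /ecst enum_rankK /wcst /wpair /= !enum_valK [_ ++ _ == _]eq_sym.
Qed.

(** When [y] has degree s - 1 only the first letter of each word is taken from
    [x]. *)
Lemma top_amul (x y : vec) : filt (m + 6) y ->
  amul x y = top_form (fun w =>
    if w is a :: t then wcoef x [:: a] * wcoef y t else 0)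
    *: delta_mx 0 (enum_rank [bseq]).
Proof.
move=> fy; apply/rowP => j.
rewrite -[j]enum_valK; move: (enum_val j) => {j} w.
rewrite [RHS]mxE [in RHS]mxE eqxx /= (inj_eq enum_rank_inj).
have fxy := filtM (filt1 x) fy.
have [->|w0] := eqVneq w [bseq]; last first.
  rewrite mulr0 fxy//= enum_rankK /wdeg.
  have -> : nilp w = false.
    by apply: contraNF w0 => /nilP w0; apply/eqP/val_inj.
  by rewrite add1n ltnS size_bseq.
rewrite mulr1 mxE.
transitivity (\sum_(u : W) \sum_(v : W) wcst [bseq] u v *
    (x 0 (enum_rank u) * y 0 (enum_rank v))).
  rewrite [RHS](big_enum_val (fun u : W => \sum_(v : W) _)) /=.
  apply: eq_bigr => u _.
  rewrite [RHS](big_enum_val (fun v : W => _)) /=.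
  apply: eq_bigr => v _.
  by rewrite /ecst enum_rankK !enum_valK.
rewrite /wcst /wpair /= /top_form.
transitivity (\sum_t coef_term t * (\sum_(u : W) \sum_(v : W)
   (~~ nilp u && ~~ nilp v)%:R * (word_term t == u ++ v)%:R *
    (x 0 (enum_rank u) * y 0 (enum_rank v)))).
  under [RHS]eq_bigr => t _.
    rewrite mulr_sumr; under eq_bigr => u _ do rewrite mulr_sumr.
    over.
  rewrite [RHS]exchange_big /=; apply: eq_bigr => u _.
  rewrite [RHS]exchange_big /=; apply: eq_bigr => v _.
  rewrite mulr_sumr mulr_suml; apply: eq_bigr => t _.
  by rewrite [(_ ++ _) == _]eq_sym; ring.
apply: eq_bigr => t _; congr (_ * _).
have := size_word_term t; case: (word_term t) => [|a w' /=].
  by rewrite addnS.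
rewrite addnS => -[sw].
by rewrite amul_split ?sw//; lia.
Qed.

End WordAlgebra.

(** * Integer noncommutative polynomials *)

Definition monomial (L : Type) : Type := (L * seq L)%type.
Definition wseq (L : Type) (I : monomial L) : seq L := I.1 :: I.2.
Definition wcat (L : Type) (I J : monomial L) : monomial L := (I.1, I.2 ++ wseq J).
(** Lists of integer coefficients and nonempty words, without normalization:
    repeated words are harmless, since only values are compared. *)
Definition ipoly (L : Type) : Type := seq (int * monomial L).

Section IntegerPolynomials.
Variable L : Type.
Implicit Types f h : ipoly L.

Definition pmul f h : ipoly L :=
  [seq (u.1 * v.1, wcat u.2 v.2) | u <- f, v <- h].
Definition popp f : ipoly L := [seq (- u.1, u.2) | u <- f].
Definition pbracket f h : ipoly L := pmul f h ++ popp (pmul h f).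
Definition pvar (j : L) : ipoly L := [:: (1, (j, [::]))].

Lemma wseq_wcat (I J : monomial L) : wseq (wcat I J) = wseq I ++ wseq J.
Proof. by []. Qed.

Lemma mem_pmul (P : pred (monomial L)) (P1 P2 : pred (monomial L)) f h :
  (forall I J, P1 I -> P2 J -> P (wcat I J)) ->
  all (fun u => P1 u.2) f -> all (fun u => P2 u.2) h ->
  all (fun u => P u.2) (pmul f h).
Proof.
move=> P12 + Ph; rewrite /pmul.
elim: f => [//|u f ih] /= /andP[Pu /ih Pf]; rewrite all_cat Pf andbT.
rewrite all_map; apply: sub_all Ph => v Pv /=; exact: P12.
Qed.

Lemma all_popp (P : pred (monomial L)) f :
  all (fun u => P u.2) (popp f) = all (fun u => P u.2) f.
Proof. by rewrite all_map. Qed.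

Lemma mem_pbracket (P P1 P2 : pred (monomial L)) f h :
  (forall I J, P1 I -> P2 J -> P (wcat I J)) ->
  (forall I J, P1 I -> P2 J -> P (wcat J I)) ->
  all (fun u => P1 u.2) f -> all (fun u => P2 u.2) h ->
  all (fun u => P u.2) (pbracket f h).
Proof.
move=> P12 P21 Pf Ph; rewrite all_cat all_popp (mem_pmul P12)//=.
by apply: (@mem_pmul P P2 P1) => // I J PI PJ; exact: P21.
Qed.

End IntegerPolynomials.

Section Evaluation.
Variables (R : realType) (A : nilalg R) (L : Type).
Local Notation vec := 'rV[R]_(adim A).
Local Notation G := (nilpotent_lie A).
Variable x : L -> vec.
Implicit Types f h : ipoly L.

Fixpoint mono_seq (j : L) (I : seq L) : vec :=
  if I is i :: I' then amul (x j) (mono_seq i I') else x j.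

Definition mono (I : monomial L) : vec := mono_seq I.1 I.2.

Lemma mono_wcat I J : mono (wcat I J) = amul (mono I) (mono J).
Proof.
case: I J => [i I] [j J]; rewrite /mono /wcat /=.
by elim: I i => [//|i' I ih] i /=; rewrite ih amulA.
Qed.

Lemma mono_filt I : filt (size (wseq I)) (mono I).
Proof.
case: I => [i I]; rewrite /mono /=; elim: I i => [|j I ih] i /=; first exact: filt1.
by rewrite -add1n; apply: filtM; [exact: filt1|exact: ih].
Qed.

Definition ev f : vec := \sum_(u <- f) u.1%:~R *: mono u.2.

Lemma ev_nil : ev [::] = 0. Proof. exact: big_nil. Qed.

Lemma ev_cat f h : ev (f ++ h) = ev f + ev h.
Proof. by rewrite /ev big_cat. Qed.

Lemma ev_popp f : ev (popp f) = - ev f.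
Proof.
rewrite /ev big_map -sumrN; apply: eq_bigr => u _.
by rewrite mulrNz scaleNr.
Qed.

Lemma ev_pmul f h : ev (pmul f h) = amul (ev f) (ev h).
Proof.
rewrite /ev /pmul big_allpairs_dep amul_suml; apply: eq_bigr => u _.
rewrite amul_sumr; apply: eq_bigr => v _ /=.
by rewrite mono_wcat intrM amulZl amulZr scalerA.
Qed.

Lemma ev_pbracket f h :
  ev (pbracket f h) = amul (ev f) (ev h) - amul (ev h) (ev f).
Proof. by rewrite ev_cat ev_popp !ev_pmul. Qed.

Lemma ev_pvar j : ev (pvar j) = x j.
Proof. by rewrite /ev big_seq1 /= scale1r. Qed.

(** The values of integer polynomials; they form a subgroup for the group law
    because the inverse is a polynomial too. *)
Definition integral_span : set vec := [set a | exists f, a = ev f]%classic.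

Lemma integral_span_gmul a b :
  integral_span a -> integral_span b -> integral_span (gmul a b).
Proof.
move=> [f ->] [h ->]; exists (f ++ h ++ pmul f h).
by rewrite !ev_cat ev_pmul addrA.
Qed.

Lemma integral_span_ginv a : integral_span a -> integral_span (ginv a).
Proof.
move=> [f ->]; rewrite /ginv; elim: (step A) => [|n [h ih]] /=.
  by exists [::]; rewrite ev_nil.
by exists (popp f ++ popp (pmul f h)); rewrite ih ev_cat !ev_popp ev_pmul.
Qed.

Lemma word_ball_span n (a : G) :
  word_ball (range (x : L -> G)) n a -> integral_span (a : vec).
Proof.
elim: n a => [a ->|n ih a [b lb [c /ih cn <-]]].
  by exists [::]; rewrite ev_nil.
apply: integral_span_gmul => //.
case: lb => [[[j _ <-]|[_ [j _ <-] <-]]|->].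
- by exists (pvar j); rewrite ev_pvar.
- by apply: integral_span_ginv; exists (pvar j); rewrite ev_pvar.
- by exists [::]; rewrite ev_nil.
Qed.

(** [f] is homogeneous of degree [d] and is the leading form of [g]. *)
Definition leads (d : nat) (g : G) f : Prop :=
  all (fun u => size (wseq u.2) == d) f /\ filt d.+1 ((g : vec) - ev f).

Lemma ev_filt d f : all (fun u => size (wseq u.2) == d) f -> filt d (ev f).
Proof.
rewrite /ev; elim: f => [_|u f ih /= /andP[/eqP du /ih fd]].
  by rewrite big_nil; exact: filt0.
rewrite big_cons; apply: filtD => //; apply: filtZ.
rewrite -du; exact: mono_filt.
Qed.

Lemma leads_var j : leads 1 (x j : G) (pvar j).
Proof.
by split => //; rewrite ev_pvar subrr; exact: filt0.
Qed.

Lemma leads_commg d e (g h : G) f f' : leads d g f -> leads e h f' ->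
  leads (d + e) [~ g, h]%g (pbracket f f').
Proof.
move=> [fd gf] [f'e hf']; split.
  apply: (mem_pbracket (P := fun I => size (wseq I) == (d + e)%N)
    (P1 := fun I => size (wseq I) == d)
    (P2 := fun I => size (wseq I) == e)) => // I J /eqP <- /eqP <-.
  - by rewrite wseq_wcat size_cat.
  - by rewrite wseq_wcat size_cat addnC.
have lg : filt d (g : vec).
  rewrite -[X in filt _ X](subrK (ev f)); apply: filtD; last exact: ev_filt.
  exact: filt_le gf.
have lh : filt e (h : vec).
  rewrite -[X in filt _ X](subrK (ev f')); apply: filtD; last exact: ev_filt.
  exact: filt_le hf'.
rewrite ev_pbracket.
have := filt_commg lg lh; set c := ([~ g, h]%g : vec) => hc.
have -> : c - (amul (ev f) (ev f') - amul (ev f') (ev f)) =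
   (c - (amul (g : vec) h - amul (h : vec) g)) +
   ((amul (g : vec) ((h : vec) - ev f') + amul ((g : vec) - ev f) (ev f')) -
    (amul (h : vec) ((g : vec) - ev f) + amul ((h : vec) - ev f') (ev f))).
  rewrite !amulBr !amulDl !amulNl.
  move: (amul (g : vec) h) (amul (h : vec) g) => P Q.
  move: (amul (ev f) (ev f')) (amul (ev f') (ev f)) => U V.
  move: (amul (g : vec) (ev f')) (amul (h : vec) (ev f)) => S T.
  by clear; apply/rowP => j; rewrite !mxE; ring.
apply: filtD => //; apply: filtB; apply: filtD.
- by rewrite -addnS; apply: filtM.
- by rewrite -addSn; apply: filtM => //; exact: ev_filt.
- by rewrite addnC -addnS; apply: filtM.
- by rewrite addnC -addSn; apply: filtM => //; exact: ev_filt.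
Qed.

End Evaluation.

(** * Values of monomials *)

Section TensorValue.
Variables (R : comNzRingType) (L C : Type) (v : L -> C -> R).

(** The coefficient of the word [w] in the tensor product of the vectors [v i],
    [i] running over [I]. *)
Fixpoint mval (I : seq L) (w : seq C) : R :=
  if (I, w) is (i :: I', a :: w') then v i a * mval I' w' else 1.

Lemma mval_enum n (I : seq L) (h : 'I_n -> C) (i0 : L) : size I = n ->
  mval I [seq h t | t <- enum 'I_n] = \prod_(t < n) v (nth i0 I t) (h t).
Proof.
elim: n I h => [|n ih] [|i I] h //=; first by rewrite big_ord0.
move=> [sI]; rewrite enum_ordSl /= big_ord_recl /= -map_comp ih//.
Qed.

End TensorValue.

Section SumOverWords.
Variables (R : numDomainType) (k : nat).

Fixpoint sumw (d : nat) (F : seq 'I_k -> R) : R :=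
  if d is d'.+1 then \sum_a sumw d' (fun w => F (a :: w)) else F [::].

Lemma eq_sumw d F H : (forall w, size w = d -> F w = H w) -> sumw d F = sumw d H.
Proof.
elim: d F H => [|d ih] F H FH /=; first exact: FH.
by apply: eq_bigr => a _; apply: ih => w wd; apply: FH; rewrite /= wd.
Qed.

Lemma sumwZ d c F : sumw d (fun w => c * F w) = c * sumw d F.
Proof.
elim: d F => [//|d ih] F /=; rewrite mulr_sumr.
by apply: eq_bigr => a _; rewrite ih.
Qed.

Lemma sumw_sum d (I : Type) (r : seq I) (F : I -> seq 'I_k -> R) :
  sumw d (fun w => \sum_(i <- r) F i w) = \sum_(i <- r) sumw d (F i).
Proof.
elim: d F => [//|d ih] F /=.
by rewrite exchange_big /=; apply: eq_bigr => a _; exact: ih.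
Qed.

Lemma le_sumw d F H : (forall w, size w = d -> `|F w| <= H w) ->
  `|sumw d F| <= sumw d H.
Proof.
elim: d F H => [|d ih] F H FH /=; first exact: FH.
apply: le_trans (ler_norm_sum _ _ _) _; apply: ler_sum => a _.
by apply: ih => w wd; apply: FH; rewrite /= wd.
Qed.

(** Tensor powers of a matrix and of its inverse are inverse to each other. *)
Lemma sumw_inverse (M N : 'M[R]_k) d (I J : seq 'I_k) :
  M *m N = 1%:M -> size I = d -> size J = d ->
  sumw d (fun w => mval (fun i a => M i a) I w * mval (fun j a => N a j) J w) =
  (I == J)%:R.
Proof.
move=> MN; elim: d I J => [[]//[]// _ _|d ih [|i I]//[|j J]//= [sI] [sJ]].
  by rewrite /= mulr1.
transitivity (\sum_a M i a * N a j * (I == J)%:R).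
  apply: eq_bigr => a _; rewrite -(ih I J)// -sumwZ; apply: eq_sumw => w _.
  by rewrite mulrACA.
rewrite -mulr_suml eqseq_cons.
have /matrixP/(_ i j) := MN; rewrite !mxE => ->.
by rewrite -natrM mulnb.
Qed.

Lemma sumw_norm_le (N : 'M[R]_k) d (J : seq 'I_k) : size J = d ->
  sumw d (fun w => `|mval (fun j a => N a j) J w|) <=
  (1 + \sum_a \sum_j `|N a j|) ^+ d.
Proof.
elim: d J => [[]// _|d ih [|j J]//= [sJ]]; first by rewrite /= normr1.
have S0 : 0 <= \sum_a \sum_j `|N a j|.
  by apply: sumr_ge0 => a _; apply: sumr_ge0.
rewrite [leLHS](_ : _ = (\sum_a `|N a j|) *
    sumw d (fun w => `|mval (fun j a => N a j) J w|)).
  rewrite exprS; apply: ler_pM.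
  - exact: sumr_ge0.
  - apply: (le_trans (normr_ge0 (sumw d (fun w => mval (fun j a => N a j) J w)))).
    exact: le_sumw.
  - rewrite (le_trans (_ : _ <= \sum_a \sum_j `|N a j|))//; last by rewrite lerDr.
    apply: ler_sum => a _; rewrite (bigD1 j)//= lerDl; exact: sumr_ge0.
  - exact: ih.
rewrite mulr_suml; apply: eq_bigr => a _; rewrite -sumwZ.
by apply: eq_sumw => w _; rewrite normrM.
Qed.

End SumOverWords.

Section WordValues.
Variables (R : realType) (m : nat) (alpha : R) (p : nat).
Local Notation K := m.+2.
Local Notation A := (word_algebra m alpha).
Local Notation vec := 'rV[R]_(adim A).
Local Notation G := (nilpotent_lie A).
Local Notation W := ((m + 6).-bseq 'I_K).
Variable x : 'I_p -> vec.

Definition layer (i : 'I_p) (a : 'I_K) : R := wcoef (x i) [:: a].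

Lemma wcoef_mono I (w : seq 'I_K) : size (wseq I) = size w ->
  (size w <= m + 6)%N -> wcoef (mono x I) w = mval layer (wseq I) w.
Proof.
case: I => [i I]; rewrite /mono /wseq /=; elim: I i w => [|j I ih] i [|a w]//=.
  by case: w => //= _ _; rewrite mulr1.
move=> [sw] wm; rewrite wcoef_amul//; first by rewrite ih// ltnW.
- by rewrite -sw.
- by rewrite -sw; exact: (@mono_filt _ _ _ x (j, I)).
Qed.

Definition top_vec : vec := delta_mx 0 (enum_rank ([bseq] : W)).

(** In degree s a monomial depends only on the first layers, through the form
    ell. *)
Lemma mono_top I : size (wseq I) = (m + 7)%N ->
  mono x I = top_form alpha (mval layer (wseq I)) *: top_vec.
Proof.
case: I => [i [|j I]]; first by rewrite /wseq /=; lia.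
rewrite /wseq /= addnS => -[sI].
rewrite (_ : mono x (i, j :: I) = amul (x i) (mono x (j, I)))// top_amul; last first.
  by rewrite -sI; exact: (@mono_filt _ _ _ x (j, I)).
congr (_ *: _); apply: eq_bigr => t _; congr (_ * _).
have := size_word_term t; case: (word_term t) => [|a w /=]; first by rewrite addnS.
rewrite addnS => -[sw].
by congr (_ * _); rewrite (@wcoef_mono (j, I)) ?sw.
Qed.

Lemma mono_big I : (m + 7 < size (wseq I))%N -> mono x I = 0.
Proof. by move=> h; apply: filt_step; apply: filt_le (@mono_filt _ _ _ x I). Qed.

Lemma top_vec_filt : filt (m + 7) top_vec.
Proof.
move=> i; rewrite /top_vec mxE eqxx /=; case: eqP => [->|//].
by rewrite enum_rankK /wdeg /= ltnn.
Qed.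

End WordValues.

(** * The determinant form and discreteness of k-tuples *)

Lemma uniq_size_ord n (s : seq 'I_n) : uniq s -> (size s <= n)%N.
Proof. by move=> us; rewrite -(card_uniqP us) -[leqRHS]card_ord max_card. Qed.

Lemma wseq_eq (L : eqType) (I J : monomial L) :
  (wseq I == wseq J) = (I == J :> L * seq L).
Proof. by case: I J => [i I] [j J]; rewrite /wseq eqseq_cons xpair_eqE. Qed.

Section TopForm.
Variables (R : realType) (m : nat) (alpha : R) (p : nat).
Local Notation K := m.+2.
Variable v : 'I_p -> 'I_K -> R.
Implicit Types (i j a b : 'I_p) (tl I : seq 'I_p).

Definition row_det a b tl : R :=
  \det (\matrix_(r < K, c < K) v (nth a [:: a, b & tl] r) c).

Definition minor2 i j : R :=
  v i (letter m false) * v j (letter m true) - v i (letter m true) * v j (letter m false).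

Definition first_coord i : R := v i ord0.

(** The Leibniz formula, with the first two rows singled out. *)
Lemma row_detE a b tl : size tl = m ->
  row_det a b tl = \sum_(sigma : 'S_K) (-1) ^+ sigma *
    (v a (sigma ord0) * v b (sigma (lift ord0 ord0)) * mval v tl (perm_tail sigma)).
Proof.
move=> stl; apply: eq_bigr => sigma _; congr (_ * _).
rewrite big_ord_recl big_ord_recl (mval_enum v _ a stl) -mulrA !mxE; congr (_ * (_ * _)).
by apply: eq_bigr => t _; rewrite mxE.
Qed.

(** This identifies the expanded form with products of determinants. *)
Lemma top_form_mval i0 i1 i2 i3 i4 i5 i6 tl : size tl = m ->
  top_form alpha (mval v [:: i0, i1, i2, i3, i4, i5, i6 & tl]) =
  minor2 i0 i6 * (first_coord i2 * first_coord i3 * first_coord i5) * row_det i1 i4 tl +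
  alpha * (minor2 i2 i3 * (first_coord i0 * first_coord i4 * first_coord i6) * row_det i1 i5 tl).
Proof.
move=> stl; rewrite !row_detE// !mulr_sumr -big_split /=.
rewrite /top_form.
transitivity (\sum_(sigma : 'S_K) \sum_(b : bool) \sum_(first : bool)
    coef_term alpha (sigma, b, first) *
    mval v [:: i0, i1, i2, i3, i4, i5, i6 & tl] (word_term (sigma, b, first))).
  rewrite pair_bigA /= pair_bigA /=; apply: eq_bigr => -[[sigma b] first] _ //.
apply: eq_bigr => sigma _; rewrite big_bool /= !big_bool /=.
rewrite /first_coord /minor2; set T := mval v tl _.
rewrite expr0 expr1; move: T ((-1) ^+ sigma : R) => T eps.
rewrite /letter; move: (sigma ord0) (sigma _) => s0 s1.
move: (ord0 : 'I_K) (lift ord0 ord0 : 'I_K) => z0 z1.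
move: (v i0 z0) (v i0 z1) (v i2 z0) (v i2 z1) (v i3 z0) (v i3 z1) (v i6 z0) (v i6 z1).
move: (v i1 s0) (v i4 s1) (v i4 z0) (v i5 s1) (v i5 z0).
by clear; intros; ring.
Qed.

Lemma row_det_nonuniq a b tl : size tl = m -> ~~ uniq [:: a, b & tl] ->
  row_det a b tl = 0.
Proof.
move=> stl /(uniqPn a)[r1 [r2 [r12 r2K e]]].
have r2m : (r2 < K)%N by rewrite -stl.
have r1m : (r1 < K)%N by exact: ltn_trans r2m.
apply: (@determinant_alternate _ _ _ (Ordinal r1m) (Ordinal r2m)).
  by rewrite -val_eqE /= ltn_eqF.
by move=> c; rewrite !mxE e.
Qed.

(** The determinant takes its K rows among all factors but the first one, so it
    vanishes when these do not involve K different letters. *)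
Lemma top_form_degenerate I : size I = (m + 7)%N ->
  (forall s, {subset s <= behead I} -> uniq s -> (size s < K)%N) ->
  top_form alpha (mval v I) = 0.
Proof.
rewrite !addnS addn0.
case: I => [|i0 [|i1 [|i2 [|i3 [|i4 [|i5 [|i6 tl]]]]]]] //= [stl] nu.
have nuniq a : a \in [:: i4; i5] -> ~~ uniq [:: i1, a & tl].
  move=> a45; apply/negP => us.
  suff : (size [:: i1, a & tl] < K)%N by rewrite /= stl ltnn.
  apply: nu us => c.
  rewrite !inE in a45 *; case/or3P => [->//|/eqP ->|->]; rewrite ?orbT//.
  by case/orP: a45 => ->; rewrite ?orbT.
by rewrite top_form_mval// !row_det_nonuniq ?mulr0 ?addr0 ?nuniq ?inE ?eqxx ?orbT.
Qed.

Lemma top_form_few_letters I : (p < K)%N -> size I = (m + 7)%N ->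
  top_form alpha (mval v I) = 0.
Proof.
move=> pK sI; apply: top_form_degenerate => // s _ us.
exact: leq_ltn_trans (uniq_size_ord us) pK.
Qed.

Lemma top_form_missing_letter I j : (p <= K)%N -> size I = (m + 7)%N ->
  j \notin behead I -> top_form alpha (mval v I) = 0.
Proof.
move=> pK sI jI; apply: top_form_degenerate => // s sub us.
have : uniq (j :: s) by rewrite /= us andbT; apply: contra jI; exact: sub.
by move=> /uniq_size_ord /= h; exact: leq_trans h pK.
Qed.

End TopForm.

Section Discreteness.
Variables (R : realType) (m : nat) (alpha : R).
Local Notation K := m.+2.
Local Notation k := m.+1.
Local Notation A := (word_algebra m alpha).
Local Notation vec := 'rV[R]_(adim A).
Variable x : 'I_k -> vec.

Definition widen_letter (i : 'I_k) : 'I_K := widen_ord (leqnSn k) i.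

Let M : 'M[R]_k := \matrix_(i, j) layer x i (widen_letter j).
Hypothesis M_unit : M \in unitmx.

Let beta : R := 1 + \sum_a \sum_j `|invmx M a j|.

Let beta_ge1 : 1 <= beta.
Proof.
by rewrite lerDl; apply: sumr_ge0 => a _; apply: sumr_ge0.
Qed.

Definition collect (f : ipoly 'I_k) (I : monomial 'I_k) : int :=
  \sum_(u <- f | u.2 == I) u.1.

Lemma ev_collect (f : ipoly 'I_k) :
  ev x f = \sum_(I <- undup (map snd f)) (collect f I)%:~R *: mono x I.
Proof.
rewrite /ev (eq_big_seq (fun u => \sum_(I <- undup (map snd f) | u.2 == I) u.1%:~R *: mono x I)).
  rewrite (exchange_big_dep xpredT) //=; apply: eq_bigr => I _.
  by rewrite /collect raddf_sum scaler_suml.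
move=> u uf; rewrite -big_filter (_ : [seq I <- _ | _] = [:: u.2]) ?big_seq1//.
have u2 : u.2 \in undup (map snd f) by rewrite mem_undup; apply/mapP; exists u.
rewrite -[RHS](filter_pred1_uniq (undup_uniq _) u2).
by apply: eq_filter => I; rewrite -[LHS]/(u.2 == I) eq_sym.
Qed.

(** Let d be the least degree of a word with nonzero collected coefficient.  If d
    is less than s, the coefficients of degree d are recovered from the
    coordinates of degree d with the help of the inverse matrix of the first
    layers; being integers, they cannot be small.  If d is at least s, the value
    is zero. *)
Lemma span_gap (a : vec) : integral_span x a -> a != 0 ->
  exists w, (size w <= m + 6)%N /\ 1 <= 2 * beta ^+ (m + 6) * `|wcoef a w|.
Proof.
move=> [f ->{a}]; rewrite ev_collect; set U := undup _; set a := \sum_(_ <- _) _.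
pose P d := (d < m + 7)%N && has (fun I => (size (wseq I) == d) && (collect f I != 0)) U.
have [exP a0|noP] := pselect (exists d, P d); last first.
  case/eqP; apply: big1_seq => I /= IU.
  have [c0|c0] := eqVneq (collect f I) 0; first by rewrite c0 scale0r.
  have [sI|] := ltnP (size (wseq I)) (m + 7).
    exfalso; apply: noP; exists (size (wseq I)); rewrite /P sI.
    by apply/hasP; exists I => //; rewrite eqxx.
  rewrite leq_eqVlt => /orP[/eqP sI|sI]; last by rewrite mono_big ?scaler0.
  by rewrite mono_top// top_form_few_letters// ?scale0r ?scaler0.
have [d /andP[dm /hasP[I0 I0U /andP[/eqP sI0 c0]]] dmin] := ex_minnP exP.
have coefE (w : seq 'I_K) : size w = d ->
    wcoef a w = \sum_(I <- U) (collect f I)%:~R * ((size (wseq I) == d)%:R * mval (layer x) (wseq I) w).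
  move=> wd; rewrite /a; have -> : wcoef (\sum_(I <- U) (collect f I)%:~R *: mono x I) w =
      \sum_(I <- U) wcoef ((collect f I)%:~R *: mono x I) w.
    elim: (U) => [|I r ih]; rewrite ?big_nil ?big_cons.
      by rewrite -(scale0r 0) wcoefZ mul0r.
    by rewrite wcoefD ih.
  apply: eq_big_seq => I IU; rewrite wcoefZ.
  have [->|cI] := eqVneq (collect f I) 0; first by rewrite !mul0r.
  congr (_ * _); have [sI|sI] := eqVneq (size (wseq I)) d.
    by rewrite mul1r wcoef_mono// ?sI// wd -ltnS -addnS.
  rewrite mul0r; apply: (@wcoef_filt _ _ _ (size (wseq I))).
    exact: (@mono_filt _ _ _ x I).
  have d0 : (0 < d)%N by rewrite -sI0.
  rewrite wd d0 /= ltn_neqAle eq_sym sI /= leqNgt.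
  apply/negP => Id; have /dmin : P (size (wseq I)).
    by rewrite /P (ltn_trans Id)//=; apply/hasP; exists I => //; rewrite eqxx.
  by rewrite leqNgt Id.
have inv : (collect f I0)%:~R = sumw d (fun w : seq 'I_k =>
    wcoef a (map widen_letter w) * mval (fun j b => invmx M b j) (wseq I0) w).
  transitivity (\sum_(I <- U) (collect f I)%:~R * ((I == I0)%:R : R)).
    rewrite (big_rem I0)//= eqxx mulr1 big1_seq ?addr0// => I /= IU.
    rewrite (_ : (I == I0) = false) ?mulr0//; apply: contraTF IU => /eqP ->.
    by rewrite mem_rem_uniqF// undup_uniq.
  have mapv I w : mval (layer x) I (map widen_letter w) = mval (fun i b => M i b) I w.
    elim: I w => [|i I ih] [|b w]//=; by rewrite ih mxE.
  transitivity (\sum_(I <- U) sumw d (fun w => (collect f I)%:~R *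
      (size (wseq I) == d)%:R * (mval (fun i b => M i b) (wseq I) w *
       mval (fun j b => invmx M b j) (wseq I0) w))).
    apply: eq_bigr => I _; rewrite sumwZ.
    have [sI|sI] := eqVneq (size (wseq I)) d.
      by rewrite mulr1 (sumw_inverse (mulmxV M_unit))// wseq_eq.
    rewrite mulr0 mul0r (_ : (I == I0) = false) ?mulr0//.
    by apply: contraNF sI => /eqP ->; rewrite sI0.
  rewrite -sumw_sum; apply: eq_sumw => w wd.
  rewrite coefE ?size_map// mulr_suml; apply: eq_bigr => I _.
  by rewrite mapv !mulrA.
have [//|small] := pselect (exists w : seq 'I_K, (size w <= m + 6)%N /\ 1 <= 2 * beta ^+ (m + 6) * `|wcoef a w|).
exfalso.
have dm6 : (d <= m + 6)%N by rewrite -ltnS -addnS.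
have bpos : 0 < beta ^+ (m + 6) by rewrite exprn_gt0// (lt_le_trans _ beta_ge1).
have : `|(collect f I0)%:~R : R| <= 2^-1.
  rewrite inv; apply: (@le_trans _ _ (sumw d (fun w : seq 'I_k =>
      (2 * beta ^+ (m + 6))^-1 * `|mval (fun j b => invmx M b j) (wseq I0) w|))).
    apply: le_sumw => w wd; rewrite normrM ler_wpM2r//.
    rewrite -[leRHS]mul1r ler_pdivlMr ?mulr_gt0// mulrC.
    rewrite leNgt; apply/negP => /ltW h; apply: small.
    by exists (map widen_letter w); rewrite size_map wd.
  rewrite sumwZ invfM -mulrA ler_piMr ?invr_ge0// ler_pdivrMl// mulr1.
  by apply: le_trans (sumw_norm_le _ sI0) _; apply: ler_weXn2l.
have : 1 <= `|(collect f I0)%:~R : R|.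
  by rewrite -intr_norm ler1z -gtz0_ge1 normr_gt0.
lra.
Qed.

End Discreteness.

(** * Near relations between k + 1 elements *)

Section LetterChange.
Variables (L L' : Type) (h : L -> L').

Definition pmap_letter (f : ipoly L) : ipoly L' :=
  [seq (u.1, (h u.2.1, map h u.2.2)) | u <- f].

Lemma pmap_letter_pmul f g :
  pmap_letter (pmul f g) = pmul (pmap_letter f) (pmap_letter g).
Proof.
rewrite /pmap_letter /pmul map_allpairs allpairs_mapl allpairs_mapr.
by apply: eq_allpairs => u v /=; rewrite /wcat /= map_cat.
Qed.

Lemma pmap_letter_pbracket f g :
  pmap_letter (pbracket f g) = pbracket (pmap_letter f) (pmap_letter g).
Proof.
by rewrite /pbracket -!pmap_letter_pmul /pmap_letter map_cat /popp -!map_comp.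
Qed.

End LetterChange.

(** The Lie polynomial ad_X^n Y. *)
Definition ad_poly (n : nat) : ipoly bool :=
  iter n (pbracket (pvar false)) (pvar true).

Definition bracket_ad (i j : nat) : ipoly bool := pbracket (ad_poly i) (ad_poly j).

(** The alternating form on the letters X, Y; the integers [char_first] and
    [char_second] below are the values of the two families of terms of ell on a
    word in X and Y, up to a factor common to all words with two letters Y. *)
Definition alt2 (b c : bool) : int :=
  if b then (if c then 0 else -1) else (if c then 1 else 0).

Definition char_first (w : seq bool) : int :=
  alt2 (nth false w 0) (nth false w 6) * alt2 (nth false w 1) (nth false w 4).

Definition char_second (w : seq bool) : int :=
  alt2 (nth false w 2) (nth false w 3) * alt2 (nth false w 1) (nth false w 5).

Definition isum (f : ipoly bool) (q : seq bool -> int) : int :=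
  foldr (fun u z => u.1 * q (wseq u.2) + z) 0 f.

Definition weight52 (f : ipoly bool) : bool :=
  all (fun u => (size (wseq u.2) == 7) && (count id (wseq u.2) == 2)) f.

Lemma bracket_ad50 : weight52 (bracket_ad 5 0) /\
  (isum (bracket_ad 5 0) char_first = 1 /\ isum (bracket_ad 5 0) char_second = 0).
Proof. by split; [vm_compute|split; vm_compute]. Qed.

Lemma bracket_ad41 : weight52 (bracket_ad 4 1) /\
  (isum (bracket_ad 4 1) char_first = 0 /\ isum (bracket_ad 4 1) char_second = 5).
Proof. by split; [vm_compute|split; vm_compute]. Qed.

Section NearRelations.
Variables (R : realType) (m : nat) (alpha : R).
Local Notation K := m.+2.
Local Notation A := (word_algebra m alpha).
Local Notation vec := 'rV[R]_(adim A).
Local Notation G := (nilpotent_lie A).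
Variable x : 'I_K -> vec.
Local Notation v := (layer x).
Local Notation l0 := (letter m false).
Local Notation l1 := (letter m true).

Definition other_letters : seq 'I_K := [seq lift ord0 (lift ord0 t) | t <- enum 'I_m].

Lemma enum_letters : [:: l0, l1 & other_letters] = enum 'I_K.
Proof. by rewrite !enum_ordSl /= -map_comp. Qed.

Lemma size_other : size other_letters = m.
Proof. by rewrite size_map size_enum_ord. Qed.

Definition layer_mx : 'M[R]_K := \matrix_(i, j) v i j.

Lemma row_det_letters (b c : bool) :
  row_det v (letter m b) (letter m c) other_letters = (alt2 b c)%:~R * \det layer_mx.
Proof.
have nth01 (r : 'I_K) : nth l0 [:: l0, l1 & other_letters] r = r.
  by rewrite enum_letters nth_ord_enum.
have nth10 (r : 'I_K) : nth l1 [:: l1, l0 & other_letters] r = tperm l0 l1 r.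
  case: (unliftP ord0 r) => [r'|] ->; last first.
    by rewrite (tpermL l0 l1).
  case: (unliftP ord0 r') => [t|] ->; last by rewrite (tpermR l0 l1).
  have n0 : l0 != lift ord0 (lift ord0 t) by [].
  have n1 : l1 != lift ord0 (lift ord0 t) by [].
  rewrite tpermD//.
  rewrite -[RHS]nth01 /=; apply: set_nth_default.
  by rewrite size_other; exact: (ltn_ord t).
case: b c => -[] /=.
- rewrite mul0r; apply: row_det_nonuniq; first exact: size_other.
  by rewrite /= ?inE ?eqxx.
- have -> : row_det v l1 l0 other_letters = \det (row_perm (tperm l0 l1) layer_mx).
    by congr (\det _); apply/matrixP => r c; rewrite !mxE nth10.
  by rewrite row_permE det_mulmx det_perm odd_tperm /=.
- rewrite mul1r; congr (\det _); apply/matrixP => r c.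
  by rewrite !mxE nth01.
- rewrite mul0r; apply: row_det_nonuniq; first exact: size_other.
  by rewrite /= ?inE ?eqxx.
Qed.

Lemma minor2_letters (b c : bool) :
  minor2 v (letter m b) (letter m c) = (alt2 b c)%:~R * minor2 v l0 l1.
Proof. by rewrite /minor2; case: b c => -[] /=; rewrite ?mul0r ?mul1r; ring. Qed.

Definition generic_value : R :=
  minor2 v l0 l1 * first_coord v l0 ^+ 3 * \det layer_mx.

(** Two of the letters must be Y, one in the determinant and one in the minor;
    then the three remaining factors are all X, and the value is an integer
    multiple of the same quantity. *)
Lemma top_form_letters (w : seq bool) : size w = 7%N -> count id w = 2%N ->
  top_form alpha (mval v (map (letter m) w ++ other_letters)) =
  ((char_first w)%:~R + alpha * (char_second w)%:~R) * generic_value.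
Proof.
case: w => [|b0 [|b1 [|b2 [|b3 [|b4 [|b5 [|b6 []]]]]]]]// _ cw.
rewrite [map _ _ ++ _]/= top_form_mval ?size_other// !row_det_letters.
rewrite !(minor2_letters _ b6) !(minor2_letters _ b3).
rewrite /char_first /char_second /= /generic_value.
move: (minor2 v l0 l1) (\det layer_mx) => M D.
have [y0 [y1 cE]] : exists y0 y1, forall b, first_coord v (letter m b) = if b then y1 else y0.
  by exists (first_coord v l0), (first_coord v l1) => -[].
have aE b c : ((alt2 b c)%:~R : R) = if b then (if c then 0 else -1) else (if c then 1 else 0).
  by case: b c => -[].
rewrite !intrM !aE !cE; clear cE aE.
move: cw; case: b0 b1 b2 b3 b4 b5 b6 => -[] -[] -[] -[] -[] -[] //= _; ring.
Qed.

Definition pform (f : ipoly 'I_K) (tl : seq 'I_K) : R :=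
  \sum_(u <- f) u.1%:~R * top_form alpha (mval v (wseq u.2 ++ tl)).

Lemma ev_pform f : all (fun u => size (wseq u.2) == m + 7)%N f ->
  ev x f = pform f [::] *: top_vec m alpha.
Proof.
move=> /allP sf; rewrite /pform scaler_suml; apply: eq_big_seq => u /sf /eqP su.
by rewrite cats0 mono_top// scalerA.
Qed.

Lemma pform_pmap (f : ipoly bool) : weight52 f ->
  pform (pmap_letter (letter m) f) other_letters =
  ((isum f char_first)%:~R + alpha * (isum f char_second)%:~R) * generic_value.
Proof.
rewrite /pform big_map; elim: f => [|u f ih].
  by rewrite big_nil /= mulr0 addr0 mul0r.
move=> /andP[/andP[/eqP su /eqP cu] /ih {}ih]; rewrite big_cons ih.
rewrite [top_form alpha _](top_form_letters su cu).
by rewrite /= !intrD !intrM; ring.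
Qed.

(** In the bracket with a new letter j, the terms that begin with j vanish: the
    determinant skips the first factor, and j occurs nowhere else. *)
Lemma pform_pbracket f j tl :
  all (fun u => (j \notin wseq u.2 ++ tl) && (size (wseq u.2 ++ tl) == m + 6)%N) f ->
  pform (pbracket f (pvar j)) tl = pform f (j :: tl).
Proof.
move=> /allP hf; rewrite /pform /pbracket big_cat /= [X in _ + X]big1_seq ?addr0.
  rewrite /pmul big_allpairs_dep; apply: eq_bigr => u _.
  by rewrite big_seq1 /= mulr1 -catA.
move=> w /andP[_ /mapP[u' u'in ->]]; move: u'in; rewrite /pmul /= cats0 => /mapP[u uf ->].
have /andP[ju /eqP su] := hf _ uf.
apply/eqP; rewrite mulf_eq0; apply/orP; right; apply/eqP.
apply: (@top_form_missing_letter R m alpha K v (j :: (wseq u.2 ++ tl)) j) => //.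
by rewrite addnS -su.
Qed.

Lemma pform_foldl f l tl : uniq (l ++ tl) ->
  all (fun u => all (fun j => j \notin wseq u.2) (l ++ tl) &&
     (size (wseq u.2) + size (l ++ tl) == m + 7)%N) f ->
  pform (foldl (fun f j => pbracket f (pvar j)) f l) tl = pform f (l ++ tl).
Proof.
elim: l f => [//|j l ih] f /= /andP[jl ul] /allP hf.
rewrite ih//.
  apply: pform_pbracket; apply/allP => u /hf /andP[/andP[ju _] su].
  by rewrite mem_cat negb_or ju jl /= size_cat; lia.
apply: (mem_pbracket (P := fun I => all (fun i => i \notin wseq I) (l ++ tl) &&
     (size (wseq I) + size (l ++ tl) == m + 7)%N)
    (P1 := fun I => [&& all (fun i => i \notin wseq I) (l ++ tl)
     & size (wseq I) + (size (l ++ tl)).+1 == m + 7]%N)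
    (P2 := fun I => wseq I == [:: j])).
- move=> I J /andP[/allP hI sI] /eqP hJ; rewrite wseq_wcat hJ size_cat.
  apply/andP; split; last by move: sI; rewrite /wseq /=; lia.
  apply/allP => i il; rewrite mem_cat negb_or hI//= inE.
  by apply: contraNneq jl => <-.
- move=> I J /andP[/allP hI sI] /eqP hJ; rewrite wseq_wcat hJ size_cat.
  apply/andP; split; last by move: sI; rewrite /wseq /=; lia.
  apply/allP => i il; rewrite mem_cat inE negb_or hI// andbT.
  by apply: contraNneq jl => <-.
- by apply/allP => u /hf /andP[/andP[_ ->] /= /eqP <-].
- by rewrite /= eqxx.
Qed.

Definition ad_elt (n : nat) : G := iter n (fun g => [~ (x l0 : G), g]%g) (x l1 : G).

Lemma leads_ad n : leads x n.+1 (ad_elt n) (pmap_letter (letter m) (ad_poly n)).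
Proof.
elim: n => [|n ih]; first exact: leads_var.
rewrite /ad_poly /ad_elt !iterS pmap_letter_pbracket -[n.+2]add1n.
by apply: leads_commg => //; exact: leads_var.
Qed.

Definition near_elt (i j : nat) : G :=
  foldl (fun g l => [~ g, (x l : G)]%g) [~ ad_elt i, ad_elt j]%g other_letters.

(** The commutator lies in the top degree, hence equals its leading form. *)
Lemma near_eltE i j : (i + j = 5)%N -> weight52 (bracket_ad i j) ->
  (near_elt i j : vec) =
  (((isum (bracket_ad i j) char_first)%:~R +
    alpha * (isum (bracket_ad i j) char_second)%:~R) * generic_value) *: top_vec m alpha.
Proof.
move=> ij w52.
have leads_fold l d (g : G) f : leads x d g f ->
    leads x (d + size l) (foldl (fun g j => [~ g, (x j : G)]%g) g l)
      (foldl (fun f j => pbracket f (pvar j)) f l).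
  elim: l d g f => [|a l ih] d g f lg /=; first by rewrite addn0.
  rewrite (_ : d + (size l).+1 = d + 1 + size l)%N; last by lia.
  by apply: ih; apply: leads_commg => //; exact: leads_var.
have l7 : leads x 7 [~ ad_elt i, ad_elt j]%g (pmap_letter (letter m) (bracket_ad i j)).
  rewrite (_ : 7 = i.+1 + j.+1)%N; last by lia.
  by rewrite pmap_letter_pbracket; apply: leads_commg; exact: leads_ad.
have [sf] := leads_fold other_letters _ _ _ l7.
rewrite size_other addnC in sf * => gf.
have -> : (near_elt i j : vec) = ev x (foldl (fun f j => pbracket f (pvar j))
    (pmap_letter (letter m) (bracket_ad i j)) other_letters).
  by apply/eqP; rewrite -subr_eq0; apply/eqP; exact: filt_step.
rewrite ev_pform// pform_foldl ?cats0; last 2 first.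
- have : uniq (enum 'I_K) by exact: enum_uniq.
  by rewrite -enum_letters /= => /andP[_ /andP[]].
- rewrite size_other all_map; apply/allP => u /(allP w52) /andP[/eqP su _] /=.
  rewrite size_map; apply/andP; split; last by move: su => /= ->; rewrite addnC.
  apply/allP => a aO; suff : a \notin map (letter m) (wseq u.2) by [].
  apply/negP => /mapP[b _ ab].
  have : uniq (enum 'I_K) by exact: enum_uniq.
  rewrite -enum_letters /= inE negb_or => /and3P[/andP[_ n0] n1 _].
  by move: aO; rewrite ab; case: b {ab}; apply/negP.
by rewrite pform_pmap.
Qed.

End NearRelations.

(** * A real number with extremely good approximations *)

Section Liouville.
Variable R : realType.

(** Convergents p / q of a sum of inverses of integers, each dividing the next;
    the factor from one denominator to the next exceeds (n + 2)^(q + 1). *)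
Fixpoint approx (n : nat) : nat * nat :=
  if n is n'.+1 then
    let: (p, q) := approx n' in
    let c := (4 * n.+1 ^ q.+1)%N in ((p * c + 1)%N, (q * c)%N)
  else (1, 1)%N.

Local Notation num n := (approx n).1.
Local Notation den n := (approx n).2.
Local Notation fac n := (4 * n.+2 ^ (den n).+1)%N.

Lemma numS n : num n.+1 = (num n * fac n + 1)%N.
Proof. by rewrite /=; case: (approx n). Qed.

Lemma denS n : den n.+1 = (den n * fac n)%N.
Proof. by rewrite /=; case: (approx n). Qed.

Lemma fac_ge4 n : (4 <= fac n)%N.
Proof. by rewrite leq_pmulr// expn_gt0. Qed.

Lemma den_gt0 n : (0 < den n)%N.
Proof.
by elim: n => [//|n ih]; rewrite denS muln_gt0 ih (leq_trans _ (fac_ge4 n)).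
Qed.

Lemma num_lt n : (num n + 1 <= 2 * den n)%N.
Proof.
elim: n => [//|n ih]; rewrite numS denS.
have := fac_ge4 n; move: (fac n) (num n) (den n) ih => c p q; nia.
Qed.

Let S n : R := (num n)%:R / (den n)%:R.

Let den0 n : (den n)%:R != 0 :> R.
Proof. by rewrite pnatr_eq0 -lt0n den_gt0. Qed.

Let denp n : 0 < (den n)%:R :> R.
Proof. by rewrite ltr0n den_gt0. Qed.

Let SS n : S n.+1 = S n + (den n.+1)%:R^-1.
Proof.
have f0 : (fac n)%:R != 0 :> R.
  by rewrite pnatr_eq0 -lt0n (leq_trans _ (fac_ge4 n)).
have key (c p q : nat) : c%:R != 0 :> R -> q%:R != 0 :> R ->
    (p * c + 1)%:R / (q * c)%:R = p%:R / q%:R + (q * c)%:R^-1 :> R.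
  by move=> c0 q0; rewrite natrD !natrM; field; rewrite q0 c0.
by rewrite /S numS denS; exact: key.
Qed.

Let upper_nonincr n k : S (n + k)%N + (den (n + k)%N)%:R^-1 <= S n + (den n)%:R^-1.
Proof.
elim: k => [|k ih]; first by rewrite addn0.
apply: le_trans ih; rewrite addnS SS -addrA lerD2l.
have h : (2 * den (n + k) <= den (n + k).+1)%N.
  by rewrite denS mulnC leq_mul2l (leq_trans _ (fac_ge4 _)) ?orbT.
rewrite -(ler_nat R) natrM in h.
have := denp (n + k)%N; have := denp (n + k).+1.
move: ((den (n + k).+1)%:R : R) ((den (n + k))%:R : R) h => b a ab b0 a0.
rewrite -mulr2n -[b^-1 *+ 2]mulr_natr -ler_pdivlMl ?invr_gt0// invrK.
by rewrite ler_pdivlMr// mulrC.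
Qed.

Let lower_incr n k : S n <= S (n + k)%N.
Proof.
elim: k => [|k ih]; first by rewrite addn0.
by apply: le_trans ih _; rewrite addnS SS lerDl invr_ge0 ler0n.
Qed.

Let S_le n k : S k <= S n + (den n)%:R^-1.
Proof.
have [kn|nk] := leqP k n.
  rewrite -(subnKC kn) (le_trans (lower_incr k (n - k)))// lerDl.
  by rewrite invr_ge0 ler0n.
rewrite -(subnKC (ltnW nk)); apply: le_trans (upper_nonincr n (k - n)).
by rewrite lerDl invr_ge0 ler0n.
Qed.

Lemma super_liouville : exists alpha : R, forall M : nat,
  exists p q : nat, [/\ (0 < q)%N, (p <= 2 * q)%N, 0 < `|q%:R * alpha - p%:R| &
    `|q%:R * alpha - p%:R| * M%:R ^+ q * M%:R < 1].
Proof.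
pose E : set R := range S.
have supE : has_sup E.
  split; first by exists (S 0%N); exists 0%N.
  by exists (S 0%N + (den 0%N)%:R^-1) => _ [k _ <-].
exists (sup E) => M.
have lo : S M < sup E.
  apply: (@lt_le_trans _ _ (S M.+1)); first by rewrite SS ltrDl invr_gt0; exact: denp.
  by apply: sup_upper_bound => //; exists M.+1.
have diffE : (den M)%:R * sup E - (num M)%:R = (den M)%:R * (sup E - S M).
  by rewrite mulrBr /S mulrCA mulfV// mulr1.
exists (num M), (den M); rewrite diffE; split.
- exact: den_gt0.
- by have := num_lt M; lia.
- by rewrite gtr0_norm mulr_gt0 ?subr_gt0 ?denp.
- have up : sup E <= S M + 2 / (den M.+1)%:R.
    apply: sup_le_ub; first by case: supE.
    move=> _ [k _ <-]; rewrite (le_trans (S_le M.+1 k))// SS -addrA lerD2l.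
    by rewrite mulrDl !mul1r.
  rewrite ger0_norm; last by rewrite mulr_ge0// subr_ge0 ltW.
  have M2 : M%:R ^+ den M * M%:R <= M.+2%:R ^+ (den M).+1 :> R.
    by rewrite -exprSr ler_pXn2r ?nnegrE// ler_nat; lia.
  have p0 : 0 < M.+2%:R ^+ (den M).+1 :> R by rewrite exprn_gt0.
  have d0 := denp M.
  apply: (@le_lt_trans _ _ (2^-1)); last by lra.
  apply: (@le_trans _ _ ((den M)%:R * (2 / (den M.+1)%:R) * M.+2%:R ^+ (den M).+1)).
    rewrite -mulrA; apply: ler_pM => //.
    - by rewrite mulr_ge0// subr_ge0 ltW.
    - by rewrite ler_pM2l// lerBlDl.
  rewrite denS !natrM natrX; move: (M.+2%:R ^+ _) ((den M)%:R : R) p0 d0 => a b a0 b0.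
  by rewrite le_eqVlt; apply/orP; left; apply/eqP; field; rewrite !gt_eqF.
Qed.

End Liouville.

(** * Word balls *)

Section WordBall.
Variables (R : realType) (n : nat) (G : lieGroupType R n).
Variable S : set G.

Lemma word_ball1 r : word_ball S r 1%g.
Proof.
elim: r => [//|r ih]; exists 1%g; first by right.
by exists 1%g => //; rewrite mulg1.
Qed.

Lemma word_ballM r s (a b : G) :
  word_ball S r a -> word_ball S s b -> word_ball S (r + s) (a * b)%g.
Proof.
move=> + Bb; elim: r a => [a ->|r ih a [l Sl [c Bc <-]]].
  by rewrite mul1g add0n.
by rewrite addSn; exists l => //; exists (c * b)%g; [exact: ih|rewrite mulgA].
Qed.

Lemma word_ball_le r s (a : G) : (r <= s)%N -> word_ball S r a -> word_ball S s a.
Proof.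
move=> rs Ba; rewrite -(subnKC rs) -[a]mulg1; apply: word_ballM => //.
exact: word_ball1.
Qed.

Lemma word_ball_letter (a : G) : letters S a -> word_ball S 1 a.
Proof. by move=> Sa; exists a => //; exists 1%g => //; rewrite mulg1. Qed.

Lemma lettersV (a : G) : letters S a -> letters S (a^-1)%g.
Proof.
case=> [[Sa|[b Sb <-]]|->].
- by left; right; exists a.
- by left; left; rewrite invgK.
- by right; rewrite /= invg1.
Qed.

Lemma word_ballV r (a : G) : word_ball S r a -> word_ball S r (a^-1)%g.
Proof.
elim: r a => [a ->|r ih a [l Sl [c Bc <-]]]; first by rewrite /= invg1.
rewrite invgM -addn1; apply: word_ballM; first exact: ih.
by apply: word_ball_letter; exact: lettersV.
Qed.

Lemma word_ballX r (a : G) s : word_ball S r a -> word_ball S (s * r) (a ^+ s)%g.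
Proof.
move=> Ba; elim: s => [|s ih]; first by rewrite expg0; exact: word_ball1.
by rewrite expgS mulSn; exact: word_ballM.
Qed.

Lemma word_ball_commg r s (a b : G) : word_ball S r a -> word_ball S s b ->
  word_ball S (r + (s + (r + s))) [~ a, b]%g.
Proof.
by move=> Ba Bb; do 3 ?apply: word_ballM => //; exact: word_ballV.
Qed.

End WordBall.

(** At most 2 k + 1 choices for each letter. *)
Lemma card_word_ball (R : realType) (n : nat) (G : lieGroupType R n) k
    (x : 'I_k -> G) r : (1 <= #|` fset_set (word_ball (range x) r)| <= (2 * k + 1) ^ r)%N.
Proof.
pose ls := 1%g :: codom x ++ codom (fun i => (x i)^-1%g).
have lsP a : letters (range x) a -> a \in ls.
  rewrite inE mem_cat; case=> [[[i _ <-]|[_ [i _ <-] <-]]|->]; rewrite ?eqxx//.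
    by rewrite codom_f orbT.
  by rewrite (codom_f (fun i => (x i)^-1%g)) !orbT.
pose ws := fix ws r : seq G := if r is r'.+1 then [seq (a * b)%g | a <- ls, b <- ws r'] else [:: 1%g].
have wsP a : word_ball (range x) r a -> a \in ws r.
  elim: (r) a => [a ->|s ih a [l /lsP ll [c /ih cw <-]]]; first by rewrite inE.
  by apply/allpairsP; exists (l, c).
have sws : size (ws r) = ((2 * k + 1) ^ r)%N.
  elim: (r) => [//|s ih]; rewrite expnS -ih [LHS]size_allpairs; congr (_ * _)%N.
  by rewrite /ls /= size_cat !size_codom card_ord; lia.
have sub : word_ball (range x) r `<=` [set` seq_fset tt (ws r)].
  by move=> a /wsP; rewrite -(seq_fsetE tt).
have fin : finite_set (word_ball (range x) r).
  exact: sub_finite_set sub (finite_fset _).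
apply/andP; split.
  by rewrite cardfs_gt0; apply/fset0Pn; exists 1%g; rewrite in_fset_set// inE; exact: word_ball1.
rewrite -sws (leq_trans _ (size_undup (ws r)))// -(size_seq_fset tt).
apply: fsubset_leq_card; apply/fsubsetP => a; rewrite in_fset_set// inE.
exact: sub.
Qed.

Lemma powR_exprM (R : realType) (b e : R) (q L : nat) : 0 <= b ->
  powR b (e * L%:R) ^+ q = powR (b ^+ (q * L)) e.
Proof.
move=> b0; have -> : b ^+ (q * L) = powR b (q * L)%:R by rewrite powR_mulrn.
transitivity (powR (powR b (e * L%:R)) q%:R).
  by rewrite powR_mulrn// powR_ge0.
by rewrite -2!powRrM natrM; congr powR; ring.
Qed.

Lemma liouville_contradiction (R : realFieldType) (c C d P Tq Mq M : R) :
  0 <= C -> 0 < c -> 0 <= d -> 0 <= Tq -> 0 <= M ->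
  c * P <= C * d -> 1 <= Tq * P -> Tq <= Mq -> d * Mq * M < 1 -> C < c * M ->
  False.
Proof.
move=> C0 c0 d0 Tq0 M0 h1 h2 h3 h4 h5.
have h6 : c <= C * d * Mq.
  apply: (@le_trans _ _ (c * (Tq * P))); first by rewrite ler_pMr.
  apply: (@le_trans _ _ (C * d * Tq)); last by rewrite ler_wpM2l// mulr_ge0.
  by rewrite mulrCA mulrC ler_wpM2r.
have h7 : c * M <= C.
  apply: (@le_trans _ _ (C * d * Mq * M)); first by rewrite ler_wpM2r.
  rewrite (_ : C * d * Mq * M = C * (d * Mq * M)); last by ring.
  by rewrite ler_piMr// ltW.
by move: (lt_le_trans h5 h7); rewrite ltxx.
Qed.

(** * Diophantine properties of the group *)

Section Main.
Variables (R : realType) (m : nat) (alpha : R).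
Local Notation K := m.+2.
Local Notation k := m.+1.
Local Notation A := (word_algebra m alpha).
Local Notation vec := 'rV[R]_(adim A).
Local Notation G := (nilpotent_lie A).
Local Notation W := ((m + 6).-bseq 'I_K).

Lemma size_letter_word (a : 'I_K) : (size [:: a] <= m + 6)%N.
Proof. by rewrite addnS. Qed.

Definition letter_word (a : 'I_K) : W := Bseq (size_letter_word a).

Definition letter_index (a : 'I_K) : 'I_(adim A) := enum_rank (letter_word a).

Lemma letter_index_inj : injective letter_index.
Proof. by move=> a b /enum_rank_inj/(congr1 val) /= [->]. Qed.

Lemma letter_index_deg a : adeg (letter_index a) = 1%N.
Proof. by rewrite /= enum_rankK. Qed.

Lemma layerE p (x : 'I_p -> vec) i a : layer x i a = x i 0 (letter_index a).
Proof. by rewrite /layer (wcoefE (x i) (letter_word a)). Qed.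

Variable g : G -> 'M[R]_(adim A).
Hypothesis gR : riemannian_metric g.
Hypothesis gL : left_invariant_metric g.

(** The group generated by the tuple is discrete, so any exponent will do. *)
Lemma unit_layer_diophantine (x : gtuple G k) :
  \det (first_layer (fun j => letter_index (widen_letter j)) x) != 0 ->
  beta_diophantine g 1 (range x).
Proof.
move=> dx.
have Mu : (\matrix_(i, j) layer (x : 'I_k -> vec) i (widen_letter j)) \in unitmx.
  rewrite unitmxE unitfE; apply: contraNN dx => /eqP dx0; apply/eqP.
  rewrite -[RHS]dx0; congr (\det _); apply/matrixP => i j.
  by rewrite !mxE layerE.
have gap := span_gap Mu.
set b := (1 + _)%R in gap.
have b0 : 0 < 2 * b ^+ (m + 6).
  rewrite mulr_gt0// exprn_gt0// ltr_pwDl//.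
  by apply: sumr_ge0 => i _; apply: sumr_ge0.
have [c c0 dist_ge] := riemannian_dist_ge gR gL.
pose delta := (2 * b ^+ (m + 6))^-1.
have d0 : 0 < delta by rewrite invr_gt0.
pose eta := 1 - (1 + delta ^+ 2)^-1.
have eta0 : 0 < eta.
  by rewrite subr_gt0 invf_lt1 ?ltrDl ?exprn_gt0// addr_gt0// exprn_gt0.
exists (c * eta); first by rewrite mulr_gt0.
move=> r r1; apply: le_ereal_inf_tmp => _ [a [Ba a1] <-].
apply: le_trans (dist_ge (a : vec)); rewrite lee_fin.
have [w [_ hw]] : exists w, (size w <= m + 6)%N /\ 1 <= 2 * b ^+ (m + 6) * `|wcoef (a : vec) w|.
  apply: gap; first exact: (word_ball_span Ba).
  by apply/eqP => a0; apply: a1; rewrite /= a0.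
have da : delta <= `|a : vec|.
  apply: le_trans (wcoef_norm (a : vec) w).
  by rewrite -[leLHS]mulr1 ler_pdivrMl.
have sa : delta ^+ 2 <= sqnorm (a : vec).
  apply: le_trans (sqr_norm_le_sqnorm _).
  by apply: lerXn2r => //; rewrite nnegrE; [exact: ltW|exact: normr_ge0].
have pw : powR #|` fset_set (word_ball (range x) r)|%:R (- 1) <= 1 :> R.
  have /andP[N1 _] := card_word_ball x r.
  set N := (_%:R : R); have N1' : 1 <= N by rewrite ler1n.
  by have := ler_powR N1' (lerN10 R); rewrite powRr0.
apply: (@le_trans _ _ (c * eta)).
  by rewrite ler_piMr// mulr_ge0// ltW.
rewrite ler_pM2l// lerD2l lerN2 /depth lef_pV2 ?posrE ?lerD2l//.
  by rewrite ltr_pwDl// sqnorm_ge0.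
by rewrite ltr_pwDl// sqr_ge0.
Qed.

Lemma diophantine_few : diophantine_for_tuples g k.
Proof.
exists 1 => // mu mu_haar.
have inj : injective (fun j : 'I_k => letter_index (widen_letter j)).
  by move=> i j /letter_index_inj/(congr1 val) /= /val_inj.
have [N [mN N0 subN]] := ae_first_layer_unit mu_haar inj (fun i => letter_index_deg _).
exists N; split=> // x ndx; apply: subN => dx; apply: ndx.
exact: unit_layer_diophantine.
Qed.

Hypothesis alphaL : forall M : nat,
  exists p q : nat, [/\ (0 < q)%N, (p <= 2 * q)%N, 0 < `|q%:R * alpha - p%:R| &
    `|q%:R * alpha - p%:R| * M%:R ^+ q * M%:R < 1].

Definition top_elt (a : R) : G := (a *: top_vec m alpha : vec).

Lemma top_eltM (a b : R) : (top_elt a * top_elt b)%g = top_elt (a + b).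
Proof.
rewrite lie_mulgE /gmul /top_elt (_ : amul _ _ = 0) ?addr0 ?scalerDl//.
apply: (@filt_step _ A); rewrite -[X in filt X _]addn1; apply: filtM; last exact: filt1.
by apply: filtZ; exact: top_vec_filt.
Qed.

Lemma top_elt0 : top_elt 0 = 1%g.
Proof. exact: scale0r. Qed.

Lemma top_eltX (a : R) r : (top_elt a ^+ r)%g = top_elt (r%:R * a).
Proof.
elim: r => [|r ih]; first by rewrite mul0r top_elt0.
by rewrite expgS ih top_eltM -natr1 mulrDl mul1r addrC.
Qed.

Lemma top_eltV (a : R) : ((top_elt a)^-1)%g = top_elt (- a).
Proof. by apply: (@mulgI G (top_elt a)); rewrite mulgV top_eltM subrr top_elt0. Qed.

Lemma near_elt_ball (x : 'I_K -> vec) i j :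
  exists L, word_ball (range (x : 'I_K -> G)) L (near_elt x i j).
Proof.
pose S := range (x : 'I_K -> G).
have Bx a : word_ball S 1 (x a : G).
  by apply: word_ball_letter; left; left; exists a.
have Bad n : exists L, word_ball S L (ad_elt x n).
  elim: n => [|n [L hL]]; first by exists 1%N; exact: Bx.
  by eexists; apply: word_ball_commg; [exact: Bx|exact: hL].
rewrite /near_elt; have [L1 h1] := Bad i; have [L2 h2] := Bad j.
have := word_ball_commg h1 h2; move: (_ + _)%N [~ _, _]%g => L a.
elim: (other_letters m) L a => [|b l ih] L a hL; first by exists L.
by apply: (ih _ _ (word_ball_commg hL (Bx b))).
Qed.

(** The elements c_2^q c_1^(-5p) are words of length at most L q. *)
Lemma generic_not_diophantine (x : gtuple G K) beta : 0 < beta ->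
  generic_value (x : 'I_K -> vec) != 0 -> ~ beta_diophantine g beta (range x).
Proof.
move=> beta0 D0 [c c0 hc].
set D := generic_value _ in D0.
have [w1 [s11 s12]] := bracket_ad50; have [w2 [s21 s22]] := bracket_ad41.
have E1 := near_eltE (x : 'I_K -> vec) (erefl : 5 + 0 = 5)%N w1.
have E2 := near_eltE (x : 'I_K -> vec) (erefl : 4 + 1 = 5)%N w2.
rewrite s11 s12 mulr0 addr0 mul1r -/D in E1.
rewrite s21 s22 add0r -/D in E2.
have [L1 B1] := near_elt_ball (x : 'I_K -> vec) 5 0.
have [L2 B2] := near_elt_ball (x : 'I_K -> vec) 4 1.
pose L := (L2 + 10 * L1 + 1)%N.
pose B : R := (2 * K + 1)%:R.
pose T : R := powR B (beta * L%:R).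
pose C : R := `|5 * D| * Num.sqrt (inner g 1%g (top_vec m alpha) (top_vec m alpha)).
have C0 : 0 <= C by rewrite mulr_ge0// sqrtr_ge0.
(* The ball of radius L q contributes a factor T ^+ q to the bound, the constants
   a factor C / c; both are absorbed by the approximations of quality M. *)
pose M := (Num.bound T + Num.bound (C / c) + 1)%N.
have T0 : 0 <= T by exact: powR_ge0.
have MT : T <= M%:R.
  by rewrite (le_trans (ltW (archi_boundP T0)))// ler_nat /M -addnA leq_addr.
have MC : C < c * M%:R.
  rewrite mulrC -ltr_pdivrMr// (lt_le_trans (archi_boundP (divr_ge0 C0 (ltW c0))))//.
  by rewrite ler_nat /M addnAC leq_addl.
have [p [q [q0 pq approx0 approx1]]] := alphaL M.
pose z : G := ((near_elt (x : 'I_K -> vec) 4 1) ^+ q *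
  ((near_elt (x : 'I_K -> vec) 5 0)^-1) ^+ (5 * p))%g.
pose tau := 5 * D * (q%:R * alpha - p%:R).
have zE : z = top_elt tau.
  have -> : z = (top_elt (alpha * 5%:~R * D) ^+ q * (top_elt D)^-1 ^+ (5 * p))%g.
    by rewrite /z /top_elt -E1 -E2.
  rewrite top_eltV !top_eltX top_eltM; congr top_elt.
  by rewrite /tau natrM; ring.
have tau0 : tau != 0.
  apply: mulf_neq0; last by rewrite -normr_gt0.
  by apply: mulf_neq0; [rewrite pnatr_eq0|exact: D0].
have z1 : z <> 1%g.
  rewrite zE /top_elt => /rowP/(_ (enum_rank ([bseq] : W))).
  by rewrite lie_1gE !mxE !eqxx mulr1; apply/eqP.
have nL : (q * L2 + 5 * p * L1 <= q * L)%N by move: pq; rewrite /L; clear; nia.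
have Bz : word_ball (range x) (q * L) z.
  apply: (@word_ball_le _ _ _ _ (q * L2 + 5 * p * L1)); first exact: nL.
  apply: word_ballM; first exact: word_ballX.
  by apply: word_ballX; exact: word_ballV.
have dz : (min_dist g (range x) (q * L) <= (C * `|q%:R * alpha - p%:R|)%:E)%E.
  apply: ge_ereal_inf; exists (riemannian_dist g z 1%g); first by exists z.
  have fz : filt (step A) (z : vec) by rewrite zE; apply: filtZ; exact: top_vec_filt.
  apply: le_trans (dist_central_le gL fz) _; rewrite lee_fin zE innerZ.
  rewrite sqrtrM ?sqr_ge0// sqrtr_sqr /C /tau normrM.
  by rewrite le_eqVlt; apply/orP; left; apply/eqP; ring.
have qL1 : (1 <= q * L)%N by rewrite muln_gt0 q0 /L addn1.
have := le_trans (hc _ qL1) dz; rewrite lee_fin => hcz.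
have B1' : 1 <= B by rewrite ler1n addn1.
have Tq : T ^+ q * powR #|` fset_set (word_ball (range x) (q * L))|%:R (- beta) >= 1.
  have /andP[N1 NB] := card_word_ball x (q * L).
  rewrite -(ler_nat R) natrX in NB; rewrite -(ler_nat R) in N1.
  rewrite powRN; set N := (_%:R : R) in N1 NB *.
  have Np : 0 < powR N beta by rewrite powR_gt0// (lt_le_trans ltr01).
  rewrite ler_pdivlMr// mul1r.
  apply: (@le_trans _ _ (powR (B ^+ (q * L)) beta)).
    apply: ge0_ler_powR; [exact: ltW|by rewrite nnegrE| |exact: NB].
    by rewrite nnegrE exprn_ge0.
  by rewrite /T powR_exprM.
apply: (liouville_contradiction C0 c0 (normr_ge0 _) _ _ hcz Tq _ approx1 MC).
- exact: exprn_ge0.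
- exact: ler0n.
- by apply: lerXn2r => //; rewrite nnegrE.
Qed.

Lemma not_diophantine_many : ~ diophantine_for_tuples g K.
Proof.
case=> beta beta0 /(_ (@haar R A K) (@haar_haar_measure R A K)).
case=> N [mN N0 subN].
pose U : set (gtuple G K) := [set x | generic_value (x : 'I_K -> vec) != 0].
have clayer i a : continuous (fun x : gtuple G K => layer (x : 'I_K -> vec) i a).
  have -> : (fun x : gtuple G K => layer (x : 'I_K -> vec) i a) = gcoord ^~ (i, letter_index a).
    by apply/funext => x; rewrite layerE.
  exact: coord_continuous_gtuple.
have cgen : continuous (fun x : gtuple G K => generic_value (x : 'I_K -> vec)).
  have cdet : continuous (fun x : gtuple G K => \det (layer_mx (x : 'I_K -> vec))).
    apply: det_continuous => i j.
    have -> : (fun x : gtuple G K => layer_mx (x : 'I_K -> vec) i j) =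
      (fun x => layer (x : 'I_K -> vec) i j) by apply/funext => x; rewrite mxE.
    exact: clayer.
  have cM (f h : gtuple G K -> R) : continuous f -> continuous h -> continuous (fun x => f x * h x).
    by move=> cf ch x; exact: (@continuousM R _ f h x (cf x) (ch x)).
  have cB (f h : gtuple G K -> R) : continuous f -> continuous h -> continuous (fun x => f x - h x).
    by move=> cf ch x; exact: (@continuousB R _ _ f h x (cf x) (ch x)).
  apply: (cM) => //; apply: (cM); first by apply: cB; apply: (cM); exact: clayer.
  have -> : (fun x : gtuple G K => first_coord (layer (x : 'I_K -> vec)) (letter m false) ^+ 3) =
     (fun x => layer (x : 'I_K -> vec) (letter m false) ord0 *
        (layer (x : 'I_K -> vec) (letter m false) ord0 *
         layer (x : 'I_K -> vec) (letter m false) ord0)).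
    by apply/funext => x; rewrite /first_coord; ring.
  by apply: (cM); [exact: clayer|apply: (cM); exact: clayer].
have oU : open U.
  have -> : U = (fun x : gtuple G K => generic_value (x : 'I_K -> vec)) @^-1` [set t : R | t != 0] by [].
  by move/continuousP: cgen; apply; exact: open_neq.
have U0 : U !=set0.
  pose x0 : gtuple G K := fun i => (delta_mx 0 (letter_index i) : vec).
  have lx i a : layer (x0 : 'I_K -> vec) i a = (i == a)%:R.
    by rewrite layerE mxE eqxx (inj_eq letter_index_inj) eq_sym.
  exists x0; rewrite /U/= /generic_value.
  have -> : layer_mx (x0 : 'I_K -> vec) = 1%:M by apply/matrixP => i j; rewrite !mxE lx.
  rewrite det1 mulr1 /minor2 /first_coord !lx /=.
  by rewrite !mulr1 mulr0 subr0 expr1n mul1r oner_neq0.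
have [_ _ haar_open] := @haar_haar_measure R A K.
have := haar_open U oU U0.
have UN : U `<=` N.
  by move=> x Ux; apply: subN => /=; exact: generic_not_diophantine.
have mU : measurable (U : set (g_sigma_algebraType (@open (gtuple G K)))).
  exact: sub_sigma_algebra.
suff : (haar U <= 0)%E by move=> h h'; have := lt_le_trans h' h; rewrite ltxx.
by rewrite -N0; apply: le_measure => //; rewrite inE.
Qed.

End Main.

Theorem theorem1p4 (R : realType) (k : nat) (hk : (1 <= k)%N) :
  exists (n : nat) (G : lieGroupType R n),
    [/\ connected [set: G],
        nilpotent_group G
      & forall g : G -> 'M[R]_n,
          riemannian_metric g -> left_invariant_metric g ->
          diophantine_for_tuples g k /\ ~ diophantine_for_tuples g k.+1].
Proof.
case: k hk => [//|m _].
have [alpha alphaL] := super_liouville R.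
exists (adim (word_algebra m alpha)), (nilpotent_lie (word_algebra m alpha)); split.
- exact: row_connected.
- exact: nilpotent_lieP.
- move=> g gR gL; split; first exact: diophantine_few.
  exact: not_diophantine_many.
Qed.
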